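(* Let $\mathbb{F}_q$ be a finite field of odd characteristic. a) Let $k\le n$ be whole numbers. Consider the oscillator representation $\omega$ for the dual pair $(Sp_{2n},O_k)\subset Sp_{2nk}$, where $O_k$ is the isometry group of either of the two symmetric non-degenerate bilinear forms in dimension $k$. Then: 1) The representation $\omega_{|Sp_{2n}}$ is of $U$-rank $k$, and has type corresponding to $O_k$. 2) For any irreducible representation $\tau$ of $O_k$, let $\omega_\tau\simeq\Omega_\tau\otimes\tau$ be the $\tau$-isotypic subspace of $\omega$. Then, as a representation of $Sp_{2n}$, $\Omega_\tau$ contains a unique irreducible representation $\eta(\tau)$ of $U$-rank $k$ (and type of $O_k$). Furthermore, the mapping $\eta:\widehat{O}_k\hookrightarrow\widehat{Sp}_{2n}$, $\tau\mapsto\eta(\tau)$, is an injection of $\widehat{O}_k$ into the set $(\widehat{Sp}_{2n})_{U,k}$ of irreducible $U$-rank $k$ representations of $Sp_{2n}$. b) Let $k$ and $n$ be whole numbers, with $2n\le k$. Consider the oscillator representation $\omega$ for the dual pair $O_{k,k}\times Sp_{2n}\subset Sp_{4nk}$. Then: 1) The representation $\omega_{|O_{k,k}}$ has $U$-rank $2n$. 2) For any irreducible representation $\sigma$ of $Sp_{2n}$, let $\omega_\sigma\simeq\Upsilon_\sigma\otimes\sigma$ be the $\sigma$-isotypic component of $\omega$. Then, as a representation of $O_{k,k}$, $\Upsilon_\sigma$ contains a unique irreducible representation $\eta(\sigma)$ of $U$-rank $2n$. Furthermore, the mapping $\eta:\widehat{Sp}_{2n}\hookrightarrow\widehat{O}_{k,k}$,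 $\sigma\mapsto\eta(\sigma)$, is an injection of $\widehat{Sp}_{2n}$ into the set $(\widehat{O}_{k,k})_{U,2n}$ of irreducible $U$-rank $2n$ representations of $O_{k,k}$. c) Let $k$ and $n$ be whole numbers, with $k\le\frac n2$. Consider the oscillator representation $\omega$ for the dual pair $GL_k\times GL_n\subset Sp_{2kn}$. Then: 1) The representation $\omega_{|GL_n}$ has $U$-rank $k$. 2) For any irreducible representation $\nu$ in $\widehat{GL}_k$, let $\omega_\nu\simeq\Xi_\nu\otimes\nu$ be the $\nu$-isotypic component of $\omega$. Then, as a representation of $GL_n$, $\Xi_\nu$ contains a unique irreducible representation $\eta(\nu)$ of $U$-rank $k$. Furthermore, the mapping $\eta:\widehat{GL}_k\hookrightarrow\widehat{GL}_n$, $\nu\mapsto\eta(\nu)$, is an injection of $\widehat{GL}_k$ into the set $(\widehat{GL}_n)_{U,k}$ of irreducible $U$-rank $k$ representations of $GL_n$.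
   Context: All representations are finite dimensional and complex; $\widehat G$ is the set of isomorphism classes of irreducible representations of $G$. All groups are over $\mathbb{F}_q$: $GL_n=GL_n(\mathbb{F}_q)$; on $\mathbb{F}_q^{2n}$ with coordinates $(x_1,\dots,x_n,y_1,\dots,y_n)$, $Sp_{2n}$ is the isometry group of $\sum_j(x_jy'_j-y_jx'_j)$ and $O_{n,n}$ is the isometry group of $\sum_j(x_jy'_j+y_jx'_j)$. Oscillator representation: for a symplectic space $(W,\langle\,,\rangle)$ over $\mathbb{F}_q$, the Heisenberg group is $H(W)=W\oplus\mathbb{F}_q$ with law $(w,t)(w',t')=(w+w',t+t'+\frac12\langle w,w'\rangle)$. Fix a nontrivial additive character $\chi$ of $\mathbb{F}_q$ and let $\rho_\chi$ be the unique irreducible representation of $H(W)$ with central character $\chi$. The oscillator (Weil) representation $\omega$ of $Sp(W)$ acts on the space of $\rho_\chi$ and satisfies $\omega(g)\rho_\chi(w,t)\omega(g)^{-1}=\rho_\chi(gw,t)$. In its standard normalization, in the model on $L^2(Y)$ attached to a decomposition $W=X\oplus Y$ into Lagrangian subspaces, the elements of $Sp(W)$ preserving $X$ and $Y$ act by the natural permutation action on functions on $Y$ times the quadratic-residue symbol of the determinant of their action on $Y$. Dual pairs: a dual pair in a group is a pair of subgroups each of which is the full centralizer of the other. If $V_1$ has a symplectic form and $V_2$ a non-degenerate symmetric bilinear form, the tensor product of the two forms is a symplectic form on $V_1\otimes V_2$, which gives the pairs $(Sp_{2n},O_k)$ in $Sp_{2nk}$ and $(O_{k,k},Sp_{2n})$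 in $Sp_{4nk}$. The groups $GL_k$ and $GL_n$ act on $V=M_{k,n}$ ($k\times n$ matrices) by multiplication on the left and on the right, and hence on $V\oplus V^*\simeq M_{k,n}\oplus M_{n,k}$ with symplectic form $\langle(v,\lambda),(v',\lambda')\rangle=\lambda'(v)-\lambda(v')$; this gives the pair $(GL_k,GL_n)$ in $Sp_{2kn}$. ''The oscillator representation for the dual pair'' means the restriction of $\omega$ to the product of the two groups. $U$-rank: fix a nontrivial additive character $\chi_0$ of $\mathbb{F}_q$. (i) For $Sp_{2n}$ (respectively $O_{n,n}$), let $U$ be the abelian group of matrices $\begin{bmatrix}I&S\\0&I\end{bmatrix}$ with $S$ an $n\times n$ symmetric (respectively skew-symmetric) matrix. Each character of $U$ has the form $S\mapsto\chi_0(\mathrm{trace}(TS))$ with $T$ symmetric (respectively skew-symmetric), and its rank is the rank of $T$. The $U$-rank of a representation $\pi$ is the largest rank of a character of $U$ appearing in $\pi_{|U}$. (ii) For $GL_n$: for a block upper triangular parabolic subgroup with diagonal blocks of sizes $a_1,\dots,a_r$ and $j<l$, the group $U$ of matrices $I+T$ with $T$ supported in the $(j,l)$ block is a standard matrix subgroup of size $(a,b)=(a_j,a_l)$, isomorphic to $M_{a,b}(\mathbb{F}_q)$. Each of its characters has the form $S\mapsto\chi_0(\mathrm{trace}(TS))$ with $T\in M_{b,a}$, and its rank is the rank of $T$. For a representation $\pi$, $rank_U(\pi)$ is the largest rank of a character of $U$ appearing in $\pi_{|U}$, and the $U$-rank of $\pi$ is the largest of the numbers $rank_U(\pi)$ as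 $U$ runs over all standard matrix subgroups of $GL_n$. Type (for $Sp_{2n}$): the type of a rank $k$ character of $U$ is the isomorphism class of the symmetric bilinear form defined by $T$; there are two types of each positive rank. If, for a representation $\pi$ of $U$-rank $k$, only one of the two types of rank $k$ characters appears in $\pi_{|U}$, then $\pi$ is said to be of that type. The type corresponding to $O_k$ is the one given by the symmetric form defining $O_k$ (up to a scalar normalization depending only on the choices of $\chi$ and $\chi_0$). *)

(* Defs.v *)
From HB Require Import structures.
From mathcomp Require Import all_boot all_order all_algebra all_fingroup.
From mathcomp Require Import all_solvable all_field all_character.

Set Implicit Arguments.
Unset Strict Implicit.
Unset Printing Implicit Defensive.

Import Order.TTheory GroupScope GRing.Theory Num.Theory.
Local Open Scope ring_scope.

(* MathComp's {'GL_m[F]} lives on 'M_m.-1.+1: for m = n + n or m = k * n this  *)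
(* is not syntactically the right matrix type, and it is wrong for m = 0.      *)
(* glmx F m is the group of invertible m x m matrices for every m.             *)
Section GL.
Variables (F : finFieldType) (m : nat).

Record glmx := GLmx { glval :> 'M[F]_m; glvalP : glval \in unitmx }.

HB.instance Definition _ := [isSub for glval].
HB.instance Definition _ := [Finite of glmx by <:].

Lemma glmx1_subproof : (1%:M : 'M[F]_m) \in unitmx.
Proof. exact: unitmx1. Qed.
Lemma glmxM_subproof (g h : glmx) : (g *m h : 'M[F]_m) \in unitmx.
Proof. by rewrite unitmx_mul !glvalP. Qed.
Lemma glmxV_subproof (g : glmx) : invmx (g : 'M[F]_m) \in unitmx.
Proof. by rewrite unitmx_inv glvalP. Qed.

Definition glmx_one := GLmx glmx1_subproof.
Definition glmx_mul (g h : glmx) := GLmx (glmxM_subproof g h).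
Definition glmx_inv (g : glmx) := GLmx (glmxV_subproof g).

Lemma glmx_mulA : associative glmx_mul.
Proof. by move=> g h k; apply: val_inj; rewrite /= mulmxA. Qed.
Lemma glmx_mul1 : left_id glmx_one glmx_mul.
Proof. by move=> g; apply: val_inj; rewrite /= mul1mx. Qed.
Lemma glmx_mulV : left_inverse glmx_one glmx_inv glmx_mul.
Proof. by move=> g; apply: val_inj; rewrite /= mulVmx ?glvalP. Qed.

HB.instance Definition _ :=
  Finite_isGroup.Build glmx glmx_mulA glmx_mul1 glmx_mulV.

Lemma glvalM (g h : glmx) : ((g * h)%g : 'M[F]_m) = g *m h.
Proof. by []. Qed.
Lemma glval1 : ((1%g : glmx) : 'M[F]_m) = 1%:M.
Proof. by []. Qed.
Lemma glvalV (g : glmx) : ((g^-1)%g : 'M[F]_m) = invmx g.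
Proof. by []. Qed.

Definition bform (A : 'M[F]_m) (u v : 'cV[F]_m) : F := (u^T *m A *m v) 0 0.

Definition form_isom (A : 'M[F]_m) : {set glmx} :=
  [set g : glmx | (g : 'M[F]_m)^T *m A *m g == A].

Lemma form_isom_group_set A : group_set (form_isom A).
Proof.
apply/group_setP; split=> [|g h]; rewrite !inE.
  by rewrite glval1 trmx1 mul1mx mulmx1.
move=> /eqP gA /eqP hA; rewrite glvalM trmx_mul.
by rewrite -!mulmxA [A *m _]mulmxA [_^T *m (_ *m h)]mulmxA [_ *m (A *m g)]mulmxA
           gA mulmxA hA.
Qed.
Canonical form_isom_group A := Group (form_isom_group_set A).

End GL.

Section Forms.
Variables (F : finFieldType) (n : nat).

(* In coordinates (x_1,..,x_n,y_1,..,y_n): sum_j x_j y'_j - y_j x'_j. *)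
Definition sympl_form : 'M[F]_(n + n) := block_mx 0 1%:M (- 1%:M) 0.
(* sum_j x_j y'_j + y_j x'_j *)
Definition split_form : 'M[F]_(n + n) := block_mx 0 1%:M 1%:M 0.

End Forms.

(* The Heisenberg group of ('cV_m, A):                                         *)
(* (w, t) (w', t') = (w + w', t + t' + <w, w'>/2).                             *)
Definition heis (F : finFieldType) m (A : 'M[F]_m) : Type :=
  ('cV[F]_m * F)%type.

Section Heisenberg.
Variables (F : finFieldType) (m : nat) (A : 'M[F]_m).

HB.instance Definition _ := Finite.on (heis A).

Definition heis_mul (a b : heis A) : heis A :=
  (a.1 + b.1, a.2 + b.2 + 2%:R^-1 * bform A a.1 b.1).
Definition heis_one : heis A := (0, 0).
Definition heis_inv (a : heis A) : heis A :=
  (- a.1, - a.2 + 2%:R^-1 * bform A a.1 a.1).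

Lemma heis_mulA : associative heis_mul.
Proof.
move=> [u r] [v s] [w t]; rewrite /heis_mul /bform /=; congr (_, _).
  by rewrite addrA.
rewrite [(u + v)^T]raddfD /= !mulmxDl mulmxDr !mxE !mulrDr !addrA.
rewrite -!addrA; congr (_ + (_ + _)).
by rewrite [RHS]addrCA; congr (_ + _); rewrite addrC -addrA.
Qed.
Lemma heis_mul1 : left_id heis_one heis_mul.
Proof.
by move=> [u r]; rewrite /heis_mul /bform /= trmx0 !mul0mx mxE mulr0 !add0r addr0.
Qed.
Lemma heis_mulV : left_inverse heis_one heis_inv heis_mul.
Proof.
move=> [u r]; rewrite /heis_mul /heis_one /bform /=; congr (_, _).
  by rewrite addNr.
by rewrite linearN /= !mulNmx mxE mulrN addrAC addrK addNr.
Qed.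

HB.instance Definition _ :=
  Finite_isGroup.Build (heis A) heis_mulA heis_mul1 heis_mulV.

End Heisenberg.

Section TensorProduct.
Variable F : fieldType.

(* tprod is the Kronecker product: (i1, i2) has rank i1 * m2 + i2. *)
Lemma trow_entry n1 (A : 'rV[F]_n1) m2 n2 (B : 'M[F]_(m2, n2)) i
    (j1 : 'I_n1) (j2 : 'I_n2) (j : 'I_(n1 * n2)) :
  j = (j1 * n2 + j2)%N :> nat -> trow A B i j = A 0 j1 * B i j2.
Proof.
elim: n1 A j1 j => [|n1 IH] A j1 j /= def_j; first by case: j1 def_j.
rewrite mxE; case: splitP => [j' Ej | j' Ej].
  have ltj : (j1 * n2 + j2 < n2)%N by rewrite -def_j Ej ltn_ord.
  have j10 : j1 = 0.
    apply: val_inj => /=; case: (val j1) ltj => //= p.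
    by rewrite mulSn -addnA ltnNge leq_addr.
  rewrite !mxE; congr (A _ _ * B _ _); last first.
    by apply: val_inj; rewrite /= -Ej def_j j10.
  by apply: val_inj; rewrite /= j10.
case: (unliftP 0 j1) => [p|] Ep; last first.
  have Ej2 : j2 = (n2 + j')%N :> nat by rewrite -Ej def_j Ep.
  by have := ltn_ord j2; rewrite Ej2 ltnNge leq_addr.
rewrite (IH _ p).
  by rewrite mxE; congr (A _ _ * _); apply: val_inj; rewrite /= Ep.
apply/eqP; rewrite -(eqn_add2l n2) -Ej def_j Ep /= /bump /= add1n.
by rewrite mulSn addnA.
Qed.

Lemma tprod_entry m1 n1 (A : 'M[F]_(m1, n1)) m2 n2 (B : 'M[F]_(m2, n2))
    (i1 : 'I_m1) (i2 : 'I_m2) (j1 : 'I_n1) (j2 : 'I_n2)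
    (i : 'I_(m1 * m2)) (j : 'I_(n1 * n2)) :
  i = (i1 * m2 + i2)%N :> nat -> j = (j1 * n2 + j2)%N :> nat ->
  tprod A B i j = A i1 j1 * B i2 j2.
Proof.
move=> def_i def_j; elim: m1 A i1 i def_i => [|m1 IH] A i1 i /= def_i.
  by case: i1 def_i.
rewrite mxE; case: splitP => [i' Ei | i' Ei].
  have lti : (i1 * m2 + i2 < m2)%N by rewrite -def_i Ei ltn_ord.
  have i10 : i1 = 0.
    apply: val_inj => /=; case: (val i1) lti => //= p.
    by rewrite mulSn -addnA ltnNge leq_addr.
  rewrite (trow_entry _ _ _ def_j) mxE; congr (A _ _ * B _ _).
    by apply: val_inj; rewrite /= i10.
  by apply: val_inj; rewrite /= -Ei def_i i10.
case: (unliftP 0 i1) => [p|] Ep; last first.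
  have Ei2 : i2 = (m2 + i')%N :> nat by rewrite -Ei def_i Ep.
  by have := ltn_ord i2; rewrite Ei2 ltnNge leq_addr.
rewrite (IH _ p).
  by rewrite mxE; congr (A _ _ * _); apply: val_inj; rewrite /= Ep.
apply/eqP; rewrite -(eqn_add2l m2) -Ei def_i Ep /= /bump /= add1n.
by rewrite mulSn addnA.
Qed.

Lemma kron_index m1 m2 (i : 'I_(m1 * m2)) :
  {p : 'I_m1 * 'I_m2 | i = (p.1 * m2 + p.2)%N :> nat}.
Proof.
have m2_gt0 : (0 < m2)%N by case: m2 i => [|//] [i lti]; rewrite muln0 in lti.
have lt1 : (i %/ m2 < m1)%N by rewrite ltn_divLR.
have lt2 : (i %% m2 < m2)%N by rewrite ltn_mod.
by exists (Ordinal lt1, Ordinal lt2) => /=; apply: divn_eq.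
Qed.

Lemma trmx_tprod m1 n1 (A : 'M[F]_(m1, n1)) m2 n2 (B : 'M[F]_(m2, n2)) :
  (tprod A B)^T = tprod A^T B^T.
Proof.
apply/matrixP=> j i; rewrite mxE.
have [[i1 i2] /= Ei] := kron_index i; have [[j1 j2] /= Ej] := kron_index j.
by rewrite (tprod_entry _ _ Ei Ej) (tprod_entry _ _ Ej Ei) !mxE.
Qed.

End TensorProduct.

Section DualPairs.
Variable F : finFieldType.

Lemma tens_subproof m1 m2 (g : glmx F m1) (h : glmx F m2) :
  tprod (g : 'M[F]_m1) (h : 'M[F]_m2) \in unitmx.
Proof.
suffices: tprod (g : 'M[F]_m1) (h : 'M[F]_m2)
            *m tprod (invmx g) (invmx h) = 1%:M by case/mulmx1_unit.
by rewrite -tprodE !mulmxV ?glvalP // tprod1.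
Qed.

Definition tens m1 m2 (p : glmx F m1 * glmx F m2) : glmx F (m1 * m2) :=
  GLmx (tens_subproof p.1 p.2).

Lemma tens_morphM m1 m2 : {in setT &, {morph @tens m1 m2 : x y / (x * y)%g}}.
Proof. by move=> x y _ _; apply: val_inj; rewrite /= tprodE. Qed.
Canonical tens_morphism m1 m2 := Morphism (@tens_morphM m1 m2).

Lemma tens_sub m1 m2 (A : 'M[F]_m1) (B : 'M[F]_m2) :
  setX (form_isom A) (form_isom B)
    \subset @tens m1 m2 @*^-1 form_isom (tprod A B).
Proof.
apply/subsetP=> -[g h]; rewrite !inE /= => /andP[/eqP gA /eqP hB].
by rewrite trmx_tprod -!tprodE gA hB.
Qed.

Lemma contra_subproof m (g : glmx F m) : (invmx (g : 'M[F]_m))^T \in unitmx.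
Proof. by rewrite unitmx_tr unitmx_inv glvalP. Qed.
Definition contragredient m (g : glmx F m) : glmx F m :=
  GLmx (contra_subproof g).

Lemma contraM m (g h : glmx F m) :
  contragredient (g * h)%g = (contragredient g * contragredient h)%g.
Proof.
by apply: val_inj; rewrite /= -trmx_mul -[invmx h *m _]/(val (h^-1 * g^-1)%g) -invMg.
Qed.

(* The action of g in GL(V) on V + V^*, in dual coordinates. *)
Lemma levi_subproof m (g : glmx F m) :
  block_mx (g : 'M[F]_m) 0 0 (contragredient g) \in unitmx.
Proof. by rewrite unitmxE det_ublock unitrM -!unitmxE !glvalP. Qed.
Definition levi m (g : glmx F m) : glmx F (m + m) := GLmx (levi_subproof g).

(* (h, g) acts on M_{k,n} + M_{k,n}^* by v |-> g v h^-1 and its contragredient. *)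
(* M_{k,n} has coordinates v_ij listed row by row, so v |-> g v h^-1 is the      *)
(* Kronecker product of g and h^-T.                                              *)
Definition gl_pair n k (p : glmx F n * glmx F k) : glmx F (k * n + k * n) :=
  levi (tens (p.2, contragredient p.1)).

Lemma gl_pair_morphM n k :
  {in setT &, {morph @gl_pair n k : x y / (x * y)%g}}.
Proof.
have leviM m (g h : glmx F m) : levi (g * h)%g = (levi g * levi h)%g.
  apply: val_inj; rewrite /= mulmx_block !mulmx0 !mul0mx !addr0 !add0r.
  by congr block_mx; rewrite -[LHS]/(val (contragredient (g * h)%g)) contraM.
move=> [h g] [h' g'] _ _; rewrite /gl_pair /= -leviM contraM; congr levi.
by rewrite -[RHS](tens_morphM (in_setT _) (in_setT _)).
Qed.
Canonical gl_pair_morphism n k := Morphism (@gl_pair_morphM n k).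

Lemma levi_form_isom m (g : glmx F m) : levi g \in form_isom (sympl_form F m).
Proof.
rewrite inE /= /sympl_form tr_block_mx !mulmx_block !trmx0 trmxK.
rewrite !(mulmx0, mul0mx, addr0, add0r, mulmx1, mulmxN, mulNmx).
by rewrite mulVmx ?glvalP // -trmx_mul mulVmx ?glvalP // trmx1.
Qed.

Lemma gl_pair_sub n k :
  setX [set: glmx F n] [set: glmx F k]
    \subset @gl_pair n k @*^-1 form_isom (sympl_form F (k * n)).
Proof.
by apply/subsetP=> p _; apply/morphpreP; rewrite in_setT; split=> //; apply: levi_form_isom.
Qed.

End DualPairs.

(* V is the tau-isotypic subspace: the span of the images of all intertwiners  *)
(* from tau (acting, as in the library, on row vectors).                       *)
Definition isotypic_subspace (C : fieldType) (gT : finGroupType)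
    (G : {group gT}) d (r : mx_representation C G d) e (tau : mx_representation C G e)
    p (V : 'M[C]_(p, d)) : Prop :=
  let hom (f : 'M[C]_(e, d)) := {in G, forall h, tau h *m f = f *m r h} in
  (forall f, hom f -> (f <= V)%MS) /\
  (forall W : 'M[C]_d, (forall f, hom f -> (f <= W)%MS) -> (V <= W)%MS).

Section PairRepresentations.
Variables (C : fieldType) (gT1 gT2 : finGroupType).
Variables (G1 : {group gT1}) (G2 : {group gT2}) (d : nat).
Variable r : mx_representation C (setX G1 G2) d.

Lemma res_fst_repr : mx_repr G1 (fun g => r (g, 1%g)).
Proof.
split=> [|g h Gg Gh]; first exact: repr_mx1.
by rewrite -repr_mxM ?inE ?Gg ?Gh ?group1 //=; congr (r (_, _)); rewrite mulg1.
Qed.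
Definition res_fst := MxRepresentation res_fst_repr.

Lemma res_snd_repr : mx_repr G2 (fun h => r (1%g, h)).
Proof.
split=> [|g h Gg Gh]; first exact: repr_mx1.
by rewrite -repr_mxM ?inE ?Gg ?Gh ?group1 //=; congr (r (_, _)); rewrite mulg1.
Qed.
Definition res_snd := MxRepresentation res_snd_repr.

(* The tau-isotypic subspace of r is isomorphic to Om (x) tau; the rows of the *)
(* matrix J give the isomorphism.                                              *)
Definition multiplicity_space e (tau : mx_representation C G2 e)
    p (Om : mx_representation C G1 p) : Prop :=
  exists J : 'M[C]_(p * e, d),
    [/\ isotypic_subspace res_snd tau J, row_free J &
        {in G1 & G2, forall g h, tprod (Om g) (tau h) *m J = J *m r (g, h)}].

End PairRepresentations.

(* Om has exactly one irreducible subrepresentation satisfying P, and it is    *)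
(* isomorphic to pi.                                                           *)
Definition contains_unique (C : fieldType) (gT : finGroupType)
    (G : {group gT}) (P : forall e, mx_representation C G e -> Prop)
    p (Om : mx_representation C G p) e (pi : mx_representation C G e) : Prop :=
  exists V : 'M[C]_p, exists modV : mxmodule Om V,
    [/\ mxsimple Om V, P _ (submod_repr modV), mx_rsim pi (submod_repr modV) &
        forall (V' : 'M[C]_p) (modV' : mxmodule Om V'),
          mxsimple Om V' -> P _ (submod_repr modV') -> (V' == V)%MS].

(* The set of isomorphism classes of irreducible representations of G.         *)
Definition irr_classes (C : numClosedFieldType) (gT : finGroupType)
    (G : {group gT}) : irrType C G :=
  DecSocleType (regular_repr C G).

Section Oscillator.
Variables (F : finFieldType) (C : numClosedFieldType).

Definition nontrivial_character (chi : F -> C) : Prop :=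
  [/\ chi 0 = 1, {morph chi : x y / x + y >-> x * y} & exists x, chi x != 1].

Definition quadratic_symbol (a : F) : C :=
  if a == 0 then 0 else if [exists b : F, b ^+ 2 == a] then 1 else -1.

(* The columns of X and of Y are bases of complementary Lagrangian subspaces.  *)
Definition polarization m (A : 'M[F]_m) N (X Y : 'M[F]_(m, N)) : Prop :=
  [/\ (N + N)%N = m, row_free (row_mx X Y),
      X^T *m A *m X = 0 & Y^T *m A *m Y = 0].

Section Model.
Variables (chi : F -> C) (m : nat) (A : 'M[F]_m) (d : nat).
Variable rho : mx_representation C [set: heis A] d.
Variable omega : mx_representation C (form_isom A) d.

(* Phi identifies the space of rho with the functions on Y (with coordinates   *)
(* y in 'cV_N, the point of Y being Y *m y). The last clause, on the elements  *)
(* fixing X and W / X pointwise, belongs to the standard normalization. It is  *)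
(* a consequence of the other ones except for Sp_2(F_3): the latter group is   *)
(* not perfect, and its nontrivial characters are trivial on {1, -1}, so the   *)
(* elements preserving X and Y do not determine omega.                         *)
Definition function_model N (X Y : 'M[F]_(m, N))
    (Phi : {linear 'cV[C]_d -> {ffun 'cV[F]_N -> C^o}}) : Prop :=
  [/\ bijective Phi,
      forall v z y, Phi (rho (Y *m z, 0) *m v) y = Phi v (y - z),
      forall v x y, Phi (rho (X *m x, 0) *m v) y
                      = chi (bform A (X *m x) (Y *m y)) * Phi v y,
      forall (g : glmx F m) (a b : 'M[F]_N), g \in form_isom A ->
        g *m X = X *m a -> g *m Y = Y *m b ->
        forall v y, Phi (omega g *m v) y
                      = quadratic_symbol (\det b) * Phi v (invmx b *m y) &
      forall (g : glmx F m) (s : 'M[F]_N), g \in form_isom A ->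
        g *m X = X -> g *m Y = Y + X *m s ->
        forall v y, Phi (omega g *m v) y
          = chi (2%:R^-1 * bform A (X *m (s *m y)) (Y *m y)) * Phi v y].

End Model.

Definition oscillator (chi : F -> C) m (A : 'M[F]_m) d
    (omega : mx_representation C (form_isom A) d) : Prop :=
  exists rho : mx_representation C [set: heis A] d,
    [/\ mx_irreducible rho,
        forall t, rho (0, t) = (chi t)%:M,
        forall (g : glmx F m) w t, g \in form_isom A ->
          omega g *m rho (w, t) *m omega (g^-1)%g = rho (g *m w, t) &
        forall N (X Y : 'M[F]_(m, N)), polarization A X Y ->
          exists Phi, function_model chi rho omega X Y Phi].

Definition tensor_pair m1 m2 (A : 'M[F]_m1) (B : 'M[F]_m2) d
    (omega : mx_representation C (form_isom (tprod A B)) d) :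
    mx_representation C (setX (form_isom A) (form_isom B)) d :=
  subg_repr (morphpre_repr (tens_morphism F m1 m2) omega) (tens_sub A B).

Definition gl_dual_pair n k d
    (omega : mx_representation C (form_isom (sympl_form F (k * n))) d) :
    mx_representation C (setX [set: glmx F n] [set: glmx F k]) d :=
  subg_repr (morphpre_repr (gl_pair_morphism F n k) omega) (gl_pair_sub F n k).

End Oscillator.

Section Rank.
Variables (F : finFieldType) (C : numClosedFieldType) (chi0 : F -> C).

(* U is the image of the additive group L of matrices under u. The character   *)
(* S |-> chi0 (tr (T S)) occurs in r if and only if the corresponding joint    *)
(* eigenspace of the operators r (u S) is nonzero.                             *)
Definition character_occurs n (L : pred 'M[F]_n) (gT : Type)
    (u : 'M[F]_n -> gT) d (r : gT -> 'M[C]_d) (T : 'M[F]_n) : bool :=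
  (\bigcap_(S | L S) eigenspace (r (u S)) (chi0 (\tr (T *m S))))%MS != 0.

(* L' is the set of matrices that parametrize the characters of U.             *)
Definition rank_wrt n (L L' : pred 'M[F]_n) (gT : Type)
    (u : 'M[F]_n -> gT) d (r : gT -> 'M[C]_d) : nat :=
  \max_(T : 'M[F]_n | L' T && character_occurs L u r T) \rank T.

Lemma siegel_subproof n (S : 'M[F]_n) : block_mx 1%:M S 0 1%:M \in unitmx.
Proof. by rewrite unitmxE det_ublock !det1 mulr1 unitr1. Qed.
Definition siegel n (S : 'M[F]_n) : glmx F (n + n) := GLmx (siegel_subproof S).

Definition symmetric_mx n : pred 'M[F]_n := [pred S | S^T == S].
Definition skew_mx n : pred 'M[F]_n := [pred S | S^T == - S].

Definition Sp_urank n d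
    (r : mx_representation C (form_isom (sympl_form F n)) d) : nat :=
  rank_wrt (@symmetric_mx n) (@symmetric_mx n) (@siegel n) r.

Definition O_urank n d
    (r : mx_representation C (form_isom (split_form F n)) d) : nat :=
  rank_wrt (@skew_mx n) (@skew_mx n) (@siegel n) r.

(* A block decomposition of {0,..,n-1} is given by the sizes of its blocks;    *)
(* there are at most n nonempty ones and the list is padded with empty blocks, *)
(* which contribute rank 0 only.                                               *)
Definition is_composition n (a : {ffun 'I_n -> 'I_n.+1}) : bool :=
  (\sum_(j < n) a j == n)%N.

Definition in_block n (a : {ffun 'I_n -> 'I_n.+1}) (j i : 'I_n) : bool :=
  let start := (\sum_(j' < n | j' < j) a j')%N in
  (start <= i < start + a j)%N.

Definition block_supported n (a : {ffun 'I_n -> 'I_n.+1}) (j l : 'I_n) :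
    pred 'M[F]_n :=
  [pred T : 'M[F]_n | [forall i1, forall i2,
     (T i1 i2 != 0) ==> in_block a j i1 && in_block a l i2]].

(* I + T is unitriangular in the cases of interest; insubd supplies the proof  *)
(* of invertibility.                                                           *)
Definition unipotent n (T : 'M[F]_n) : glmx F n := insubd (1%g : glmx F n) (1%:M + T).

(* Matrices in M_{a,b} and M_{b,a} are extended by 0 to n x n matrices; this   *)
(* preserves traces of products and ranks.                                     *)
Definition GL_urank n d (r : mx_representation C [set: glmx F n] d) : nat :=
  (\max_(a : {ffun 'I_n -> 'I_n.+1} | is_composition a)
     \max_(j < n) \max_(l < n | j < l)
       rank_wrt (block_supported a j l) (block_supported a l j)
                (@unipotent n) r)%N.

(* The form T on F^n modulo its radical is isomorphic to the nondegenerate     *)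
(* form B on F^k, through the projection y^T.                                  *)
Definition same_type n k (T : 'M[F]_n) (B : 'M[F]_k) : Prop :=
  exists2 y : 'M[F]_(n, k), \rank y = k & T = y *m B *m y^T.

(* For r of U-rank k: only the type of B appears among the characters of rank  *)
(* k occurring in r.                                                           *)
Definition has_type n d (r : mx_representation C (form_isom (sympl_form F n)) d)
    k (B : 'M[F]_k) : Prop :=
  forall T : 'M[F]_n, T^T = T -> \rank T = k ->
    character_occurs (@symmetric_mx n) (@siegel n) r T -> same_type T B.

End Rank.

(* eta sends (the class of) tau to the unique irreducible subrepresentation of *)
(* the multiplicity space of tau that satisfies P.                             *)
Definition eta_correspondence (C : numClosedFieldType)
    (gT1 gT2 : finGroupType) (G1 : {group gT1}) (G2 : {group gT2}) d
    (r : mx_representation C (setX G1 G2) d)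
    (P : forall e, mx_representation C G1 e -> Prop)
    (eta : irr_classes C G2 -> irr_classes C G1) : Prop :=
  [/\ injective eta,
      forall i, P _ (irr_repr (eta i)) &
      forall e (tau : mx_representation C G2 e), mx_irreducible tau ->
        forall p (Om : mx_representation C G1 p),
          multiplicity_space r tau Om ->
          contains_unique P Om (irr_repr (eta (irr_comp (irr_classes C G2) tau)))].

(* Main.v *)
Require Import Defs.
From HB Require Import structures.
From mathcomp Require Import all_boot all_order all_algebra all_fingroup.
From mathcomp Require Import all_solvable all_field all_character.

Set Implicit Arguments.
Unset Strict Implicit.
Unset Printing Implicit Defensive.

Import Order.TTheory GroupScope GRing.Theory Num.Theory.
Local Open Scope ring_scope.

(* Write omega for the oscillator representation of G1 x G2 (G1 the larger      *)
(* group), U for the abelian subgroup of G1 and psi for a character of U of the *)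
(* maximal rank that occurs. In a Schroedinger model in which U acts by         *)
(* multiplication operators, the character of U at a point y is the Gram matrix *)
(* of y, so that the points with character psi form one free G2-orbit: the      *)
(* psi-eigenspace E of omega is the regular representation of G2. Moreover, for *)
(* the delta function v0 of one of these points, every translate v0 h (h in G2) *)
(* is a multiple of some v0 g with g in the Levi subgroup of G1, so that G1     *)
(* realizes the commutant of G2 on E. Hence the psi-eigenspace of the           *)
(* multiplicity space of an irreducible tau is contained in the G1-module       *)
(* generated by any of its nonzero vectors: exactly one irreducible submodule   *)
(* meets it, and tau can be recovered from this submodule. As the characters of *)
(* maximal rank that occur are conjugate under the Levi subgroup, to meet the   *)
(* psi-eigenspace is to have maximal U-rank.                                    *)
(* For GL_n, each standard matrix subgroup has its own Schroedinger model, on   *)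
(* functions on a mixture of matrix entries and dual matrix entries; this       *)
(* bounds all ranks by k. A character of rank k of any standard matrix subgroup *)
(* yields one of the upper right block of size (k, n - k).                      *)

(** * Intertwining operators *)

(** Let E be the eigenspace of omega for one character of maximal rank. Write vectors of E as [v0]
    times an element of the group ring of G2. Then G2 acts by right multiplications, and the group
    ring of G1 induces all left multiplications ([weight_left_op]). The part of E seen by an
    irreducible tau is Hom(tau, C[G2]), which is nonzero and irreducible under left multiplications.
    By complete reducibility a single irreducible G1-submodule of the multiplicity space of tau
    carries all of it ([weight_hom_exists], [weight_hom_cyclic], [weight_cyclic_simple]). An
    isomorphism between the submodules of tau and tau' extends to an operator commuting with G1. On
    E this operator commutes with left multiplications, so it is a right multiplication, and it maps
    the copy of tau' into the copy of tau ([weight_match_inj]). The lemma [multiplicity_embedding]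
    transfers this to an abstract multiplicity space.

    The lemma [monomial_correspondence] reduces the rest to the points of a Lagrangian. The points
    sharing the character of a base point must form a free G2-orbit, reached also by the Levi
    subgroup of G1. For the Siegel pairs the character of y is a multiple of y B y^T, and
    [gram_fiber] describes the orbit. For GL it is a multiple of y2^T y1, whose fibre is a torsor of
    GL_k. The inequalities between k and n provide base points of full rank. Finally
    [siegel_rank_weight] and [gl_rank_weight] identify maximal rank with meeting E; the harder one
    rests on [upper_eigenvector], which moves a character from any standard matrix subgroup to the
    upper right block. *)

Section Intertwiners.
Variables (C : numClosedFieldType) (gT : finGroupType) (G : {group gT}).

Lemma pchar_pgroup : [pchar C]^'.-group G.
Proof. by rewrite /pgroup pcharf'_nat pnatr_eq0 -lt0n cardG_gt0. Qed.

Definition intertwines e d (s : mx_representation C G e)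
    (r : mx_representation C G d) (f : 'M[C]_(e, d)) : Prop :=
  {in G, forall g, s g *m f = f *m r g}.

Lemma intertwines_average e d (s : mx_representation C G e)
    (r : mx_representation C G d) (M : 'M[C]_(e, d)) :
  intertwines s r (\sum_(x in G) s x^-1%g *m M *m r x).
Proof.
move=> g Gg; rewrite [in LHS](reindex_acts 'R _ Gg) ?astabsR //=.
rewrite mulmx_suml mulmx_sumr.
apply: eq_bigr => y Gy; rewrite invMg (repr_mxM r) // [in LHS]repr_mxM ?groupV //.
by rewrite !(mulmxA (s g)) -(repr_mxM s) ?groupV // mulgV repr_mx1 mul1mx mulmxA.
Qed.

(** Maschke's averaging, applied to the linear retraction [pinvmx f]. *)
Lemma equivariant_retraction e d (s : mx_representation C G e)
    (r : mx_representation C G d) (f : 'M[C]_(e, d)) :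
  intertwines s r f -> row_free f ->
  exists2 p, f *m p = 1%:M & intertwines r s p.
Proof.
move=> hf ff.
exists ((#|G|%:R)^-1 *: \sum_(x in G) r x^-1%g *m pinvmx f *m s x); last first.
  move=> g Gg; rewrite -scalemxAl -scalemxAr; congr (_ *: _).
  exact: intertwines_average.
have nzG : #|G|%:R != 0 :> C by rewrite pnatr_eq0 -lt0n cardG_gt0.
rewrite -scalemxAr mulmx_sumr (eq_bigr (fun=> 1%:M)) => [|x Gx].
  by rewrite sumr_const -scaler_nat scalerA mulVf ?scale1r.
rewrite (mulmxA f) (mulmxA f) -hf ?groupV //.
by rewrite -(mulmxA (s _)) (mulmxVp ff) mulmx1 -repr_mxM ?groupV // mulVg repr_mx1.
Qed.

Lemma intertwines_module e d (s : mx_representation C G e)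
    (r : mx_representation C G d) f :
  intertwines s r f -> mxmodule s (kermx f).
Proof.
move=> hf; apply/mxmoduleP=> g Gg; apply/sub_kermxP.
by rewrite -mulmxA hf // mulmxA mulmx_ker mul0mx.
Qed.

Lemma intertwines_free e d (s : mx_representation C G e)
    (r : mx_representation C G d) f :
  mx_irreducible s -> intertwines s r f -> f != 0 -> row_free f.
Proof.
move=> /mx_irrP[_ irr] hf nzf; rewrite -kermx_eq0; apply: contraT => nzk.
have := irr _ (intertwines_module hf) nzk; rewrite -sub1mx => /sub_kermxP.
by rewrite mul1mx => /eqP; rewrite (negPf nzf).
Qed.

Lemma intertwines_rsim e d (s : mx_representation C G e)
    (r : mx_representation C G d) f :
  mx_irreducible s -> mx_irreducible r -> intertwines s r f -> f != 0 ->
  mx_rsim s r.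
Proof.
move=> irs irr hf nzf; have ff := intertwines_free irs hf nzf.
have [p fp hp] := equivariant_retraction hf ff.
have nzp : p != 0.
  apply: contraNneq nzf => p0; move: fp; rewrite p0 mulmx0 => /(congr1 (mulmx^~ f)).
  by rewrite mul0mx mul1mx => <-.
have fp' := intertwines_free irr hp nzp.
have le1 : (e <= d)%N by have := rank_leq_col f; rewrite (eqP ff).
have le2 : (d <= e)%N by have := rank_leq_col p; rewrite (eqP fp').
by exists f => //; apply/eqP; rewrite eqn_leq le1.
Qed.

Lemma intertwines_comp e d m (s : mx_representation C G e)
    (r : mx_representation C G d) (t : mx_representation C G m) f f' :
  intertwines s r f -> intertwines r t f' -> intertwines s t (f *m f').
Proof. by move=> hf hf' g Gg; rewrite mulmxA hf // -!mulmxA hf'. Qed.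

(** A group ring element is kept as its coefficient function, so that the same element can be
    compared in several representations. *)
Definition ring_op d (r : mx_representation C G d) (c : gT -> C) : 'M_d :=
  \sum_(g in G) c g *: r g.

Lemma intertwines_ring_op e d (s : mx_representation C G e)
    (r : mx_representation C G d) f c :
  intertwines s r f -> ring_op s c *m f = f *m ring_op r c.
Proof.
move=> hf; rewrite mulmx_suml mulmx_sumr; apply: eq_bigr => g Gg.
by rewrite -scalemxAl -scalemxAr hf.
Qed.

Lemma irr_generated e (s : mx_representation C G e) (u x : 'rV_e) :
  mx_irreducible s -> u != 0 ->
  exists c, x = u *m ring_op s c.
Proof.
move=> /mx_irrP[_ irr] nzu.
have full : row_full (cyclic_mx s u).
  by apply: irr; rewrite ?cyclic_mx_module ?cyclic_mx_eq0.
have : (x <= cyclic_mx s u)%MS by apply: submx_full.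
by case/cyclic_mxP=> A /envelop_mxP[c ->] ->; exists c.
Qed.

Lemma val_submod_intertwines d (r : mx_representation C G d) (U : 'M_d)
    (modU : mxmodule r U) :
  intertwines (submod_repr modU) r (val_submod 1%:M).
Proof.
move=> g Gg; rewrite -(val_submodE (submod_mx modU g)).
rewrite -[in LHS](mul1mx (submod_mx modU g)) (val_submodJ modU) //.
Qed.

Lemma val_submod_free d (U : 'M[C]_d) : row_free (val_submod (U := U) 1%:M).
Proof. by rewrite /val_submod /= mul1mx row_base_free. Qed.

Lemma equivariant_projection d (r : mx_representation C G d) (U : 'M_d) :
  mxmodule r U ->
  exists p : 'M_d, [/\ intertwines r r p, (p <= U)%MS & U *m p = U].
Proof.
move=> modU.
have [p fp hp] := equivariant_retraction (val_submod_intertwines modU)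
                    (val_submod_free U).
exists (p *m val_submod 1%:M); split.
- exact: intertwines_comp hp (val_submod_intertwines modU).
- by rewrite -val_submodE val_submodP.
have {1}-> : U = in_submod U U *m val_submod 1%:M by rewrite -val_submodE in_submodK.
by rewrite -mulmxA (mulmxA _ p) fp mul1mx -val_submodE in_submodK.
Qed.

Lemma rsim_embedding d (r : mx_representation C G d) (M : 'M_d)
    (modM : mxmodule r M) e (s : mx_representation C G e) :
  mx_rsim s (submod_repr modM) ->
  exists f : 'M_(e, d), [/\ row_free f, intertwines s r f & (f :=: M)%MS].
Proof.
case=> B eqe fB hB; exists (B *m val_submod 1%:M); split.
- by rewrite /row_free mxrankMfree ?val_submod_free.
- exact: intertwines_comp hB (val_submod_intertwines modM).
have fullB : row_full B by rewrite /row_full (eqP fB) eqe.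
exact: eqmx_trans (eqmxMfull _ fullB) (val_submod1 _).
Qed.

Lemma cyclic_mx_hom e d (s : mx_representation C G e)
    (r : mx_representation C G d) f (x : 'rV_e) :
  intertwines s r f -> (cyclic_mx s x *m f :=: cyclic_mx r (x *m f))%MS.
Proof.
move=> hf; have hop (c : gT -> C) : \sum_(g in G) c g *: s g *m f
                                 = f *m \sum_(g in G) c g *: r g.
  by rewrite -(intertwines_ring_op c hf) mulmx_suml.
apply/eqmxP/andP; split.
  apply/row_subP=> i; rewrite row_mul.
  have /cyclic_mxP[A /envelop_mxP[c ->] ->] := row_sub i (cyclic_mx s x).
  rewrite -mulmxA mulmx_suml hop mulmxA; apply/cyclic_mxP.
  by exists (\sum_(g in G) c g *: r g) => //; apply/envelop_mxP; exists c.
rewrite cyclic_mx_sub ?submxMr ?cyclic_mx_id //.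
apply/mxmoduleP=> g Gg; rewrite -mulmxA -hf // mulmxA submxMr //.
exact: (mxmoduleP (cyclic_mx_module _ _)).
Qed.

Section SubmoduleTransport.
Variables (e d : nat) (s : mx_representation C G e) (r : mx_representation C G d).
Variables (f : 'M[C]_(e, d)) (V : 'M[C]_e) (M : 'M[C]_d).
Hypothesis hf : intertwines s r f.
Hypothesis ff : row_free f.
Hypothesis defM : (V *m f :=: M)%MS.

(** [M] only has to span the same space as [V *m f]: the image of a cyclic module is computed as
    another cyclic module. *)
Lemma mxsimple_transport : mxmodule s V -> mxsimple r M -> mxsimple s V.
Proof.
move=> modV [modM nzM minM]; split=> // [|W modW sWV nzW].
  by apply: contraNneq nzM => V0; rewrite -submx0 -defM V0 mul0mx sub0mx.
rewrite -(submxMfree _ _ ff) defM -(genmxE (W *m f)); apply: minM.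
- rewrite (eqmx_module _ (genmxE _)); apply/mxmoduleP=> g Gg.
  by rewrite -mulmxA -hf // mulmxA submxMr // (mxmoduleP modW).
- by rewrite genmxE -defM submxMr.
by rewrite -mxrank_eq0 genmxE mxrankMfree // mxrank_eq0.
Qed.

Lemma submod_rsim_transport (modV : mxmodule s V) (modM : mxmodule r M) :
  mx_rsim (submod_repr modV) (submod_repr modM).
Proof.
pose B := in_submod M (val_submod (1%:M : 'M_(\rank V)) *m f).
have EB : val_submod B = val_submod 1%:M *m f.
  by rewrite in_submodK // -defM submxMr // val_submodP.
exists B.
- by rewrite -defM mxrankMfree.
- rewrite /row_free -(mxrankMfree B (val_submod_free M)) -val_submodE EB.
  by rewrite mxrankMfree // (eqP (val_submod_free V)).
move=> g Gg; apply: val_submod_inj.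
rewrite (val_submodJ modM) // val_submodE -mulmxA -val_submodE EB.
by rewrite mulmxA (val_submod_intertwines modV) // -!mulmxA hf.
Qed.

End SubmoduleTransport.

Lemma mxsimple_meet_eq d (r : mx_representation C G d) (V W : 'M_d) (v : 'rV_d) :
  mxsimple r V -> mxsimple r W -> v != 0 -> (v <= V)%MS -> (v <= W)%MS ->
  (V == W)%MS.
Proof.
move=> [modV nzV minV] [modW nzW minW] nzv vV vW.
have modI := capmx_module modV modW.
have nzI : (V :&: W)%MS != 0.
  apply: contraNneq nzv => I0; have : (v <= V :&: W)%MS by rewrite sub_capmx vV.
  by rewrite I0 submx0.
apply/andP; split.
  by apply: submx_trans (capmxSr V W); apply: minV; rewrite ?capmxSl.
by apply: submx_trans (capmxSl V W); apply: minW; rewrite ?capmxSr.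
Qed.

End Intertwiners.

(** * The correspondence defined by a regular eigenspace *)

Section Correspondence.
Variables (C : numClosedFieldType) (gT1 gT2 : finGroupType).
Variables (G1 : {group gT1}) (G2 : {group gT2}) (d : nat).
Variable r : mx_representation C (setX G1 G2) d.

Local Notation r1 := (res_fst r).
Local Notation r2 := (res_snd r).

Lemma res_mulr g h : g \in G1 -> h \in G2 -> r1 g *m r2 h = r (g, h).
Proof.
move=> Gg Gh; rewrite -[r1 g]/(r (g, 1%g))
  -[r2 h]/(r (1%g, h)) -repr_mxM ?inE ?Gg ?Gh ?group1 //=.
by congr (r (_, _)); rewrite ?mulg1 ?mul1g.
Qed.

Lemma res_comm g h : g \in G1 -> h \in G2 -> r2 h *m r1 g = r1 g *m r2 h.
Proof.
move=> Gg Gh; rewrite res_mulr // -[r1 g]/(r (g, 1%g))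
  -[r2 h]/(r (1%g, h)) -repr_mxM ?inE ?Gg ?Gh ?group1 //=.
by congr (r (_, _)); rewrite ?mulg1 ?mul1g.
Qed.

Lemma res_snd_intertwines h : h \in G2 -> intertwines r1 r1 (r2 h).
Proof. by move=> Gh g Gg; rewrite res_comm. Qed.

Lemma ring_op_intertwines c : intertwines r1 r1 (ring_op r2 c).
Proof.
move=> g Gg; rewrite mulmx_sumr mulmx_suml; apply: eq_bigr => h Gh.
by rewrite -scalemxAl -scalemxAr res_comm.
Qed.

Lemma envelop_comm A B :
    (A \in enveloping_algebra_mx r1)%MS -> intertwines r1 r1 B ->
  A *m B = B *m A.
Proof.
case/envelop_mxP=> a -> hB; rewrite mulmx_sumr mulmx_suml.
by apply: eq_bigr => g Gg; rewrite -scalemxAl -scalemxAr hB.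
Qed.

Lemma envelop_intertwines A e (tau : mx_representation C G2 e) f :
    (A \in enveloping_algebra_mx r1)%MS ->
  intertwines tau r2 f -> intertwines tau r2 (f *m A).
Proof.
move=> EA hf h Gh; rewrite mulmxA hf // -!mulmxA (envelop_comm EA) //.
exact: res_snd_intertwines.
Qed.

Variables (U : {set gT1}) (psi : gT1 -> C) (v0 : 'rV[C]_d).

(** With several rows, the predicate says that the whole image of a map lies in the eigenspace. *)
Definition weight_space m (v : 'M[C]_(m, d)) : Prop :=
  {in U, forall u, v *m r1 u = psi u *: v}.

Hypothesis sUG : U \subset G1.

Lemma weight_mull m p (A : 'M_(p, m)) (v : 'M_(m, d)) :
  weight_space v -> weight_space (A *m v).
Proof. by move=> wv u Uu; rewrite -mulmxA wv // scalemxAr. Qed.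

Lemma weight_mulr m (v : 'M_(m, d)) A :
  intertwines r1 r1 A -> weight_space v -> weight_space (v *m A).
Proof.
by move=> hA wv u Uu; rewrite -mulmxA -hA ?(subsetP sUG) // mulmxA wv // scalemxAl.
Qed.

(** The vector [u] generates [tau], and [G2] preserves the eigenspace because it commutes with
    [U]. *)
Lemma weight_hom e (tau : mx_representation C G2 e) (u : 'rV_e) f :
  mx_irreducible tau -> intertwines tau r2 f -> u *m f != 0 ->
  weight_space (u *m f) -> weight_space f.
Proof.
move=> irr hf nzu wu g Ug; apply/row_matrixP=> i.
have nzu0 : u != 0 by apply: contraNneq nzu => ->; rewrite mul0mx.
have [c Ec] := irr_generated (row i 1%:M) irr nzu0.
have -> : row i (f *m r1 g) = row i 1%:M *m (f *m r1 g) by rewrite -row_mul mul1mx.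
have -> : row i (psi g *: f) = psi g *: (row i 1%:M *m f).
  by rewrite -row_mul mul1mx linearZ.
rewrite mulmxA Ec -(mulmxA u) (intertwines_ring_op c hf) mulmxA.
by apply: weight_mulr => //; apply: ring_op_intertwines.
Qed.

(** The group ring of [G1] commutes with [G2], so it changes the intertwiner and leaves [u]
    alone. *)
Lemma cyclic_hom e (tau : mx_representation C G2 e) (u : 'rV_e) f v :
    intertwines tau r2 f -> (v <= cyclic_mx r1 (u *m f))%MS ->
  exists2 f', intertwines tau r2 f' & v = u *m f'.
Proof.
move=> hf /cyclic_mxP[A EA ->]; exists (f *m A); first exact: envelop_intertwines.
by rewrite mulmxA.
Qed.

(** The eigenspace is a free module of rank one over the group ring of [G2], generated by [v0];
    [twist0] lets [G1] imitate on [v0] each element of [G2] up to a scalar. *)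
Hypothesis weight0 : weight_space v0.
Hypothesis weightE : forall v : 'rV_d, weight_space v ->
  exists c, v = v0 *m ring_op r2 c.
Hypothesis free0 : forall c, v0 *m ring_op r2 c = 0 -> {in G2, forall h, c h = 0}.
Hypothesis twist0 : forall h, h \in G2 -> exists g eps,
  [/\ g \in G1, eps != 0 & v0 *m r1 g = eps *: (v0 *m r2 h)].

(* On the eigenspace, identified with the group ring of G2 by c |-> v0 c, the   *)
(* group ring of G1 induces all left multiplications.                           *)
Lemma weight_left_op c :
  exists2 A, (A \in enveloping_algebra_mx r1)%MS & v0 *m A = v0 *m ring_op r2 c.
Proof.
suffices /cyclic_mxP[A EA ->] : (v0 *m ring_op r2 c <= cyclic_mx r1 v0)%MS by exists A.
rewrite mulmx_sumr summx_sub // => h Gh.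
have [g [eps [Gg nze E]]] := twist0 Gh.
rewrite -scalemxAr scalemx_sub // -[v0 *m r2 h](scalerK nze) -E scalemx_sub //.
by apply: mxmodule_trans (cyclic_mx_id _ _); rewrite ?cyclic_mx_module.
Qed.

Section Irreducible.
Variables (e : nat) (tau : mx_representation C G2 e).
Hypothesis irr : mx_irreducible tau.

(** Every irreducible occurs in the regular representation: average the rank one map [q *m v0]. One
    row of the average is [v0] times the group ring element whose coefficients are matrix
    coefficients of [tau]. *)
Lemma weight_hom_exists :
  exists f, [/\ intertwines tau r2 f, weight_space f & f != 0].
Proof.
have [e_gt0 _] := (mx_irrP tau).1 irr.
pose q : 'cV[C]_e := delta_mx (Ordinal e_gt0) 0.
exists (\sum_(x in G2) tau x^-1%g *m (q *m v0) *m r2 x); split.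
- exact: intertwines_average.
- move=> g Ug; rewrite mulmx_suml scaler_sumr; apply: eq_bigr => x Gx.
  have wx : weight_space (tau x^-1%g *m (q *m v0) *m r2 x).
    apply: weight_mulr; first exact: res_snd_intertwines.
    by do 2!apply: weight_mull.
  exact: wx.
apply/eqP=> f0.
have := @free0 (fun h => (tau h^-1%g *m q) (Ordinal e_gt0) 0).
have -> : v0 *m ring_op r2 (fun h => (tau h^-1%g *m q) (Ordinal e_gt0) 0)
        = row (Ordinal e_gt0) (\sum_(x in G2) tau x^-1%g *m (q *m v0) *m r2 x).
  rewrite mulmx_sumr linear_sum; apply: eq_bigr => x Gx /=.
  rewrite mulmxA -mulmxA row_mul -scalemxAr scalemxAl [row _ _]mx11_scalar.
  by rewrite mul_scalar_mx !mxE -scalemxAl.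
(* At the identity the matrix coefficient is a diagonal entry of the identity matrix, which
   contradicts [free0]. *)
rewrite f0 linear0 => /(_ erefl 1%g (group1 _)) /eqP.
by rewrite invg1 repr_mx1 mul1mx mxE !eqxx oner_eq0.
Qed.

(* A retraction p of f makes p f' an endomorphism of the regular representation, *)
(* hence a left multiplication, and it maps u f to u f'.                         *)
Lemma weight_hom_cyclic (u : 'rV_e) f f' :
    intertwines tau r2 f -> intertwines tau r2 f' ->
    u *m f != 0 -> weight_space (u *m f) -> weight_space (u *m f') ->
  (u *m f' <= cyclic_mx r1 (u *m f))%MS.
Proof.
move=> hf hf' nz wf wf'; apply/cyclic_mxP.
have [f'0 | nz'] := eqVneq (u *m f') 0.
  by exists (0 : 'M_d); rewrite ?f'0 ?mulmx0 ?linear0 ?sub0mx.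
have wf1 := weight_hom irr hf nz wf.
have wf2 := weight_hom irr hf' nz' wf'.
have ff : row_free f.
  by apply: intertwines_free hf _ => //; apply: contraNneq nz => ->; rewrite mulmx0.
have [p fp hp] := equivariant_retraction hf ff.
have [c Ec] := weightE wf.
have [c' Ec'] : exists c', v0 *m p *m f' = v0 *m ring_op r2 c'.
  by apply: weightE; apply: weight_mull.
have [A EA EvA] := weight_left_op c'.
exists A => //.
rewrite -[u in LHS]mulmx1 -fp mulmxA Ec -!mulmxA (mulmxA _ p).
rewrite (intertwines_ring_op c hp) -(mulmxA p) (intertwines_ring_op c hf').
rewrite !mulmxA Ec' -EvA -!mulmxA; congr (_ *m _).
exact: envelop_comm (ring_op_intertwines c).
Qed.

(** Project the generator equivariantly onto a submodule [V]. If the result is zero then so is [V];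
    otherwise it is a weight vector of the form [u *m f'], which generates [u *m f] back by
    [weight_hom_cyclic]. *)
Lemma weight_cyclic_simple (u : 'rV_e) f :
    intertwines tau r2 f -> u *m f != 0 -> weight_space (u *m f) ->
  mxsimple r1 (cyclic_mx r1 (u *m f)).
Proof.
move=> hf nz wf; split; rewrite ?cyclic_mx_module ?cyclic_mx_eq0 // => V modV sV nzV.
have [p [hp pV Vp]] := equivariant_projection modV.
have Vwp : (u *m f *m p <= V)%MS by rewrite mulmx_sub.
have [f' hf' Ef'] := cyclic_hom hf (submx_trans Vwp sV).
have [wp0 | nzwp] := eqVneq (u *m f *m p) 0.
  case/eqP: nzV; apply/row_matrixP=> i; rewrite row0 -[V]Vp row_mul.
  have /cyclic_mxP[A EA ->] : (row i V <= cyclic_mx r1 (u *m f))%MS.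
    by apply: submx_trans (row_sub _ _) sV.
  by rewrite -mulmxA (envelop_comm EA hp) mulmxA wp0 mul0mx.
rewrite cyclic_mx_sub //; apply: (submx_trans _ (_ : cyclic_mx r1 (u *m f') <= V)%MS).
  apply: weight_hom_cyclic => //; first by rewrite -Ef'.
  by rewrite -Ef'; apply: weight_mulr.
by rewrite cyclic_mx_sub // -Ef'.
Qed.

End Irreducible.

(** The graph of eta before any choice is made, expressed inside [r] and hence independent of a
    model of the multiplicity space. *)
Definition weight_match (i : irr_classes C G2) (j : irr_classes C G1) : Prop :=
  exists f (u : 'rV_(irr_degree i)),
  [/\ intertwines (irr_repr i) r2 f, weight_space (u *m f), u *m f != 0 &
      mx_rsim (irr_repr j) (submod_repr (cyclic_mx_module r1 (u *m f)))].

Lemma weight_match_exists i : exists j, weight_match i j.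
Proof.
have irr : mx_irreducible (irr_repr i) by apply: socle_irr.
have [f [hf wf nzf]] := weight_hom_exists irr.
have ff := intertwines_free irr hf nzf.
pose u : 'rV[C]_(irr_degree i) := delta_mx 0 (Ordinal (irr_degree_gt0 i)).
have nzu : u *m f != 0.
  by rewrite mulmx_free_eq0 //; apply/eqP=> /matrixP/(_ 0 (Ordinal (irr_degree_gt0 i)))
     /eqP; rewrite !mxE !eqxx oner_eq0.
have wu : weight_space (u *m f) by apply: weight_mull.
exists (irr_comp _ (submod_repr (cyclic_mx_module r1 (u *m f)))), f, u; split=> //.
apply: mx_rsim_sym; apply: rsim_irr_comp; first exact: pchar_pgroup.
by apply/submod_mx_irr; apply: weight_cyclic_simple irr _ _ _ _ _.
Qed.

(** An operator commuting with all left multiplications of the eigenspace is a right multiplication,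
    and right multiplications preserve the image of [f]; this yields a nonzero map between the two
    irreducibles. *)
Lemma weight_match_inj i i' j : weight_match i j -> weight_match i' j -> i = i'.
Proof.
move=> [f [u [hf wf nzf simf]]] [f' [u' [hf' wf' nzf' simf']]].
have irr : mx_irreducible (irr_repr i) by apply: socle_irr.
have irr' : mx_irreducible (irr_repr i') by apply: socle_irr.
have /mx_rsim_iso[g ug homg defg] := mx_rsim_trans (mx_rsim_sym simf) simf'.
(* The isomorphism [g] is equivariant only on the cyclic module; composing with the projection [p]
   makes it equivariant everywhere. *)
have [p [hp pM Mp]] := equivariant_projection (cyclic_mx_module r1 (u *m f)).
have hpg : intertwines r1 r1 (p *m g).
  move=> x Gx; rewrite mulmxA hp //.
  by apply: (hom_mxP _); rewrite ?(submx_trans pM).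
have ufp : u *m f *m (p *m g) = u *m f *m g.
  rewrite mulmxA; congr (_ *m _).
  by have /submxP[z ->] := cyclic_mx_id r1 (u *m f); rewrite -mulmxA Mp.
have [f2 hf2 Ef2] : exists2 f2, intertwines (irr_repr i') r2 f2
                              & u *m f *m g = u' *m f2.
  by apply: cyclic_hom hf' _; rewrite -defg submxMr // cyclic_mx_id.
have [c Ec] := weightE wf.
have [A EA EvA] := weight_left_op c.
have [b Eb] : exists b, v0 *m (p *m g) = v0 *m ring_op r2 b.
  by apply: weightE; apply: weight_mulr.
(* Here [A] is left multiplication by [c] and [p *m g] is right multiplication by [b]; they commute,
   so the image of [u *m f] is again in the image of [f]. *)
have Ew : u' *m f2 = u *m ring_op (irr_repr i) b *m f.
  rewrite -(mulmxA u) (intertwines_ring_op b hf) mulmxA -Ef2 -ufp Ec -EvA.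
  rewrite -[LHS]mulmxA (envelop_comm EA hpg) mulmxA Eb.
  by rewrite -!mulmxA (envelop_comm EA (ring_op_intertwines b)).
have nzg : u' *m f2 != 0.
  by rewrite -Ef2; apply: contraNneq nzf => E0; rewrite -[_ *m f](mulmxK ug) E0 mul0mx.
have ff : row_free f.
  by apply: intertwines_free hf _ => //; apply: contraNneq nzf => ->; rewrite mulmx0.
have [q fq hq] := equivariant_retraction hf ff.
have simii : mx_rsim (irr_repr i') (irr_repr i).
  apply: (intertwines_rsim irr' irr (intertwines_comp hf2 hq)).
  apply: contraNneq nzg => E0; rewrite Ew.
  by rewrite -[u *m _]mulmx1 -fq mulmxA -Ew -(mulmxA u' f2 q) E0 mulmx0 mul0mx.
have := irr_comp_rsim (irr_classes C G2) (pchar_pgroup C G2) simii.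
by rewrite !irr_reprK //; apply: pchar_pgroup.
Qed.

End Correspondence.

(** * Multiplicity spaces and their embedding *)

Section TensorRows.
Variables (C : numClosedFieldType) (p e : nat).

Definition tens_row (x : 'rV[C]_p) (u : 'rV[C]_e) : 'rV[C]_(p * e) := tprod x u.
Definition tens_left (u : 'rV[C]_e) : 'M[C]_(p, p * e) :=
  \matrix_i tens_row (delta_mx 0 i) u.
Definition tens_right (x : 'rV[C]_p) : 'M[C]_(e, p * e) :=
  \matrix_j tens_row x (delta_mx 0 j).

Lemma tens_rowE x u (i : 'I_p) (j : 'I_e) (l : 'I_(p * e)) :
  l = (i * e + j)%N :> nat -> tens_row x u 0 l = x 0 i * u 0 j.
Proof. by move=> El; apply: (@tprod_entry _ _ _ x _ _ u 0 0 i j 0 l) => //. Qed.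

Lemma tens_row_mul x u A B :
  tens_row (x *m A) (u *m B) = tens_row x u *m tprod A B.
Proof. by rewrite /tens_row tprodE. Qed.

Lemma mul_tens_left x u : x *m tens_left u = tens_row x u.
Proof.
apply/rowP=> l; have [[i j] /= El] := kron_index l.
rewrite mxE (tens_rowE _ _ El) (bigD1 i) //= mxE (tens_rowE _ _ El) !mxE !eqxx mul1r.
rewrite big1 ?addr0 // => i' ne; rewrite mxE (tens_rowE _ _ El) mxE eqxx /=.
by rewrite eq_sym (negPf ne) mul0r mulr0.
Qed.

Lemma mul_tens_right x u : u *m tens_right x = tens_row x u.
Proof.
apply/rowP=> l; have [[i j] /= El] := kron_index l.
rewrite mxE (tens_rowE _ _ El) (bigD1 j) //= mxE (tens_rowE _ _ El) !mxE !eqxx mulr1.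
rewrite big1 ?addr0 1?mulrC // => j' ne; rewrite mxE (tens_rowE _ _ El).
rewrite [delta_mx _ _ _ _]mxE eqxx /=.
by rewrite eq_sym (negPf ne) !mulr0.
Qed.

Lemma tens_left_free u : u != 0 -> row_free (tens_left u).
Proof.
move=> /rV0Pn[j nzj]; rewrite -kermx_eq0; apply/rowV0P=> x /sub_kermxP.
rewrite mul_tens_left => E0; apply/rowP=> i; rewrite !mxE.
have lt : (i * e + j < p * e)%N.
  by rewrite (leq_trans (_ : _ < i.+1 * e)%N) ?leq_mul // mulSn addnC ltn_add2r.
have := tens_rowE x u (erefl : Ordinal lt = (i * e + j)%N :> nat).
by rewrite E0 mxE => /esym/eqP; rewrite mulf_eq0 (negPf nzj) orbF => /eqP.
Qed.

Lemma mul_tens_rightC x B : B *m tens_right x = tens_right x *m tprod 1%:M B.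
Proof.
apply/row_matrixP=> j; rewrite !row_mul mul_tens_right rowK -tens_row_mul mulmx1.
by rewrite rowE.
Qed.

(* Schur's lemma, relative to the multiplicity space. *)
Lemma tens_right_cent (gT : finGroupType) (G : {group gT})
    (tau : mx_representation C G e) (Z : 'M_(e, p * e)) :
  mx_irreducible tau -> {in G, forall h, tau h *m Z = Z *m tprod 1%:M (tau h)} ->
  exists x, Z = tens_right x.
Proof.
move=> irr hZ.
(* Each component of [Z] along the multiplicity factor commutes with [tau], hence is a scalar; these
   scalars are the coordinates of [x]. *)
have /fin_all_exists[a Ea] : forall i : 'I_p,
    exists a, Z *m (tens_right (delta_mx 0 i))^T = a%:M.
  move=> i; apply/is_scalar_mxP/mx_abs_irr_cent_scalar.
    exact: group_closure_closed_field irr.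
  apply/centgmxP=> h Gh; rewrite [in RHS]mulmxA hZ // -!mulmxA; congr (_ *m _).
  apply: trmx_inj; rewrite !trmx_mul !trmxK mul_tens_rightC.
  by rewrite trmx_tprod trmx1.
exists (\row_i a i); apply/matrixP=> k l; have [[i j] /= El] := kron_index l.
rewrite mxE (tens_rowE _ _ El) !mxE /=.
have /matrixP/(_ k j) := Ea i; rewrite !mxE (bigD1 l) //= mxE mxE (tens_rowE _ _ El).
rewrite !mxE !eqxx !mulr1 big1 ?addr0 => [->|l' ne].
  by rewrite eq_sym mulr_natr.
have [[i' j'] /= El'] := kron_index l'.
rewrite [_^T _ _]mxE [tens_right _ _ _]mxE (tens_rowE _ _ El') !mxE !eqxx /=.
have [Ei|] := eqVneq i' i; rewrite ?mul0r ?mulr0 //.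
have [Ej|] := eqVneq j' j; rewrite ?mulr0 //.
by case/eqP: ne; apply: val_inj; rewrite /= El El' Ei Ej.
Qed.

End TensorRows.

Section MultiplicitySpace.
Variables (C : numClosedFieldType) (gT1 gT2 : finGroupType).
Variables (G1 : {group gT1}) (G2 : {group gT2}) (d : nat).
Variable r : mx_representation C (setX G1 G2) d.

Local Notation r1 := (res_fst r).
Local Notation r2 := (res_snd r).

(** Tensoring with a fixed [u] realizes [Om] inside the representation as the set of all [u *m g],
    for [g] an intertwiner. Surjectivity onto this set is Schur's lemma in the form
    [tens_right_cent]. *)
Lemma multiplicity_embedding e (tau : mx_representation C G2 e)
    p (Om : mx_representation C G1 p) (u : 'rV_e) :
  mx_irreducible tau -> u != 0 -> multiplicity_space r tau Om ->
  exists f : 'M_(p, d),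
    [/\ row_free f, intertwines Om r1 f,
        forall x : 'rV_p, exists2 g, intertwines tau r2 g & x *m f = u *m g &
        forall g, intertwines tau r2 g -> exists x : 'rV_p, u *m g = x *m f].
Proof.
move=> irr nzu [J [[isoJ _] freeJ homJ]].
exists (tens_left p u *m J); split.
- by rewrite /row_free mxrankMfree // (eqP (tens_left_free p nzu)).
- move=> g Gg; rewrite mulmxA.
  have -> : Om g *m tens_left p u = tens_left p u *m tprod (Om g) (tau 1%g).
    apply/row_matrixP=> i; rewrite !row_mul mul_tens_left rowK -tens_row_mul.
    by rewrite repr_mx1 mulmx1 -rowE.
  by rewrite -!mulmxA homJ.
- move=> x; exists (tens_right e x *m J); last first.
    by rewrite !mulmxA mul_tens_left mul_tens_right.
  move=> h Gh; rewrite mulmxA mul_tens_rightC -!mulmxA; congr (_ *m _).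
  by rewrite -(repr_mx1 Om) homJ.
move=> g hg; have /submxP[Z EZ] := isoJ g hg.
have [x Ex] : exists x, Z = tens_right e x.
  apply: tens_right_cent irr _ => h Gh; apply: (row_free_inj freeJ).
  rewrite -mulmxA -EZ hg // EZ -!mulmxA; congr (_ *m _).
  by rewrite -(repr_mx1 Om) homJ.
by exists x; rewrite EZ Ex !mulmxA mul_tens_left mul_tens_right.
Qed.

Variables (U : {set gT1}) (psi : gT1 -> C) (v0 : 'rV[C]_d).
Local Notation wt := (weight_space r U psi).

Variable P : forall e, mx_representation C G1 e -> Prop.

Hypothesis sUG : U \subset G1.
Hypothesis weight0 : wt v0.
Hypothesis weightE : forall v : 'rV_d, wt v ->
  exists c, v = v0 *m ring_op r2 c.
Hypothesis free0 : forall c, v0 *m ring_op r2 c = 0 -> {in G2, forall h, c h = 0}.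
Hypothesis twist0 : forall h, h \in G2 -> exists g eps,
  [/\ g \in G1, eps != 0 & v0 *m r1 g = eps *: (v0 *m r2 h)].
Hypothesis P_weight : forall e (pi : mx_representation C G1 e) f,
  mx_irreducible pi -> row_free f -> intertwines pi r1 f ->
  P pi <-> exists2 x : 'rV_e, x != 0 & wt (x *m f).

Lemma weight_match_P i j : weight_match r U psi i j -> P (irr_repr j).
Proof.
case=> f [u [hf wf nzf simf]].
have [g [gf hg Eg]] := rsim_embedding simf.
apply/(P_weight (socle_irr _) gf hg).
have /submxP[x Ex] : (u *m f <= g)%MS by rewrite Eg cyclic_mx_id.
by exists x; rewrite -?Ex //; apply: contraNneq nzf => x0; rewrite Ex x0 mul0mx.
Qed.

(** Any competing simple submodule contains a weight vector [u *m g], which generates [u *m f] by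
    [weight_hom_cyclic]. Both submodules then contain [x0], so they coincide. *)
Lemma weight_match_unique e (tau : mx_representation C G2 e) j
    p (Om : mx_representation C G1 p) :
  mx_irreducible tau -> multiplicity_space r tau Om ->
  weight_match r U psi (irr_comp (irr_classes C G2) tau) j ->
  contains_unique P Om (irr_repr j).
Proof.
move=> irr mulOm [f0 [u0 [hf0 wf0 nzf0 simf0]]].
(* [B] passes from the chosen representative of the class to [tau] itself. *)
have [B eqe freeB hB] := rsim_irr_comp (irr_classes C G2) (pchar_pgroup C G2) irr.
have fullB : row_full B by rewrite /row_full (eqP freeB); apply/eqP.
have /submxP[u Eu] : (u0 <= B)%MS by apply: submx_full.
pose f := B *m f0; have hf : intertwines tau r2 f by apply: intertwines_comp hB hf0.
have Euf : u0 *m f0 = u *m f by rewrite Eu mulmxA.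
clearbody f; move: wf0 nzf0 simf0; rewrite Euf => wf nzf simf.

have nzu : u != 0 by apply: contraNneq nzf => ->; rewrite mul0mx.
have [phi [phifree hphi toF ofF]] := multiplicity_embedding irr nzu mulOm.
have [x0 Ex0] := ofF f hf.
pose V := cyclic_mx Om x0.
have modV : mxmodule Om V := cyclic_mx_module Om x0.
have defV : (V *m phi :=: cyclic_mx r1 (u *m f))%MS.
  by rewrite Ex0; apply: cyclic_mx_hom.
have simV : mxsimple Om V.
  apply: mxsimple_transport hphi phifree defV modV _.
  by apply: (weight_cyclic_simple sUG weightE twist0 irr).
have x0V : (x0 <= V)%MS by apply: cyclic_mx_id.
have nzx0 : x0 != 0 by apply: contraNneq nzf => x00; rewrite Ex0 x00 mul0mx.
have wtP (W : 'M_p) (modW : mxmodule Om W) : mxsimple Om W ->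
    P (submod_repr modW) <-> exists2 x : 'rV_(\rank W), x != 0
      & wt (x *m (val_submod 1%:M *m phi)).
  move=> simW; apply: P_weight; first exact/submod_mx_irr.
    by rewrite /row_free mxrankMfree // (eqP (val_submod_free W)).
  exact: intertwines_comp (val_submod_intertwines modW) hphi.
exists V, modV; split=> //.
- apply/(wtP _ _ simV); exists (in_submod V x0).
    apply: contraNneq nzx0 => E0.
    by rewrite -(in_submodK x0V) E0 val_submodE mul0mx.
  by rewrite mulmxA -val_submodE in_submodK // -Ex0.
- exact: mx_rsim_trans simf (mx_rsim_sym (submod_rsim_transport hphi phifree defV _ _)).
move=> W modW simW /(wtP _ _ simW)[x nzx]; rewrite mulmxA.
have [g hg Eg] := toF (x *m val_submod 1%:M); rewrite Eg => wg.
have nzg : u *m g != 0.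
  by rewrite -Eg !mulmx_free_eq0 ?val_submod_free.
have := weight_hom_cyclic sUG weightE twist0 irr hg hf nzg wg wf.
rewrite -Eg Ex0 -(cyclic_mx_hom _ hphi) submxMfree // => x0W.
apply: mxsimple_meet_eq simW simV nzx0 _ x0V.
apply: submx_trans x0W _; rewrite cyclic_mx_sub //.
by rewrite -val_submodE val_submodP.
Qed.

Lemma weight_correspondence :
  exists2 eta, eta_correspondence r P eta &
    forall j, exists f, row_free f /\ intertwines (irr_repr (eta j)) r1 f.
Proof.
have [eta Eeta] := fin_all_exists (weight_match_exists sUG weight0 weightE free0 twist0).
exists eta; first split.
- move=> i i' Eii; apply: (weight_match_inj sUG weight0 weightE twist0 (Eeta i)).
  by rewrite Eii.
- by move=> i; apply: weight_match_P (Eeta i).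
- by move=> e tau irr p Om mul; apply: weight_match_unique irr mul (Eeta _).
move=> i; have [f [u [_ _ _ simf]]] := Eeta i.
by have [g [gf hg _]] := rsim_embedding simf; exists g.
Qed.

End MultiplicitySpace.

(** * Schroedinger models *)

Section MonomialBases.
Variables (C : numClosedFieldType) (Y : finType) (d : nat).

Definition basis_family (ev : Y -> 'rV[C]_d) : Prop :=
  (forall v, exists c : Y -> C, v = \sum_y c y *: ev y) /\
  (forall c : Y -> C, \sum_y c y *: ev y = 0 -> forall y, c y = 0).

(** By uniqueness of coordinates. This is how a character of [U] occurring in a subrepresentation is
    traced to a point of the model. *)
Lemma eigen_support (ev : Y -> 'rV[C]_d) (c : Y -> C) A (lam : Y -> C) mu y :
    basis_family ev -> (forall y, ev y *m A = lam y *: ev y) ->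
    (\sum_y c y *: ev y) *m A = mu *: \sum_y c y *: ev y ->
  c y != 0 -> lam y = mu.
Proof.
move=> [_ free] eig E nz; have := free (fun y => c y * (lam y - mu)).
have -> : \sum_y (c y * (lam y - mu)) *: ev y
          = (\sum_y c y *: ev y) *m A - mu *: \sum_y c y *: ev y.
  rewrite mulmx_suml scaler_sumr -sumrB; apply: eq_bigr => z _.
  by rewrite -scalemxAl eig !scalerA -scalerBl mulrBr [mu * _]mulrC.
rewrite E subrr => /(_ erefl y)/eqP; rewrite mulf_eq0 (negPf nz) subr_eq0.
by move/eqP.
Qed.

Lemma basis_support (ev : Y -> 'rV[C]_d) (v : 'rV[C]_d) :
  basis_family ev -> v != 0 ->
  exists c : Y -> C, v = \sum_y c y *: ev y /\ exists y, c y != 0.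
Proof.
move=> [span _] nzv; have [c Ec] := span v; exists c; split=> //.
apply/existsP; apply: contraR nzv => /existsPn c0; rewrite Ec big1 // => y _.
by have := c0 y; rewrite negbK => /eqP->; rewrite scale0r.
Qed.

Lemma basis_neq0 (ev : Y -> 'rV[C]_d) y : basis_family ev -> ev y != 0.
Proof.
move=> [_ free]; apply/eqP=> ev0; have := free (fun z => (z == y)%:R).
rewrite (bigD1 y) //= ev0 scaler0 add0r big1 => [|z /negPf->]; last by rewrite scale0r.
by move=> /(_ erefl y)/eqP; rewrite eqxx oner_eq0.
Qed.

End MonomialBases.

Section MonomialCorrespondence.
Variables (C : numClosedFieldType) (gT1 gT2 : finGroupType).
Variables (G1 : {group gT1}) (G2 : {group gT2}) (d : nat).
Variable r : mx_representation C (setX G1 G2) d.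

Local Notation r1 := (res_fst r).
Local Notation r2 := (res_snd r).

Variables (Y : finType) (ev : Y -> 'rV[C]_d).
Variables (U : {set gT1}) (Psi : Y -> gT1 -> C).
Variables (y0 : Y) (orb : gT2 -> Y) (eps : gT2 -> C).
Variable P : forall e, mx_representation C G1 e -> Prop.

(** The fibre of [Psi] through [y0] is a free orbit of [G2], so the basis vectors at its points span
    the eigenspace and are indexed by [G2]. The scalars [eps] only rescale them. *)
Lemma monomial_correspondence :
    basis_family ev -> U \subset G1 ->
    (forall y, {in U, forall u, ev y *m r1 u = Psi y u *: ev y}) ->
    {in G2, forall h, eps h != 0} ->
    {in G2, forall h, ev y0 *m r2 h = eps h *: ev (orb h)} ->
    {in G2 &, injective orb} ->
    (forall y, {in U, Psi y =1 Psi y0} -> exists2 h, h \in G2 & y = orb h) ->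
    {in G2, forall h, exists g e,
       [/\ g \in G1, e != 0 & ev y0 *m r1 g = e *: ev (orb h)]} ->
    (forall e (pi : mx_representation C G1 e) f,
       mx_irreducible pi -> row_free f -> intertwines pi r1 f ->
       P pi <-> exists2 x : 'rV_e, x != 0 & weight_space r U (Psi y0) (x *m f)) ->
  exists2 eta, eta_correspondence r P eta &
    forall j, exists f, row_free f /\ intertwines (irr_repr (eta j)) r1 f.
Proof.
move=> basis sUG hU nzeps h2 inj fib tw hP.
have [span free] := basis.
apply: (@weight_correspondence _ _ _ _ _ _ _ U (Psi y0) (ev y0)) => //.
- exact: hU.
- move=> v wv; suffices /cyclic_mxP[A /envelop_mxP[c ->] ->] :
    (v <= cyclic_mx r2 (ev y0))%MS by exists c.
  have [c Ec] := span v; rewrite Ec summx_sub // => y _.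
  have [-> | nzc] := eqVneq (c y) 0; first by rewrite scale0r sub0mx.
  (* A point with nonzero coefficient in a weight vector has the character of [y0], hence lies on
     the orbit. *)
  have [u Uu|h Gh ->] := fib y.
    apply: (eigen_support (A := r1 u) (lam := Psi^~ u) basis _ _ nzc).
      by move=> z; apply: hU.
    by rewrite -Ec wv.
  rewrite -[ev _](scalerK (nzeps h Gh)) -h2 // !scalemx_sub //.
  by apply: mxmodule_trans (cyclic_mx_id _ _); rewrite ?cyclic_mx_module.
- move=> c E0 h Gh.
  (* Collecting terms by points gives a relation between basis vectors; injectivity of [orb] leaves
     one term at each point of the orbit. *)
  have := free (fun y => \sum_(x in G2 | orb x == y) c x * eps x).
  have -> : \sum_y (\sum_(x in G2 | orb x == y) c x * eps x) *: ev y
           = ev y0 *m ring_op r2 c.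
    rewrite mulmx_sumr (partition_big orb predT) //=; apply: eq_bigr => y _.
    rewrite scaler_suml; apply: eq_bigr => x /andP[Gx /eqP <-].
    by rewrite -scalemxAr h2 // scalerA.
  move/(_ E0 (orb h)); rewrite (big_pred1 h) => [/eqP|x].
    by rewrite mulf_eq0 (negPf (nzeps h Gh)) orbF => /eqP.
  apply/andP/eqP=> [[Gx /eqP/inj] | ->]; last by rewrite Gh.
  exact.
move=> h Gh; have [g [e [Gg nze Ee]]] := tw h Gh.
exists g, (e / eps h); split=> //; first by rewrite mulf_neq0 ?invr_eq0 ?nzeps.
by rewrite h2 // scalerA divfK ?nzeps.
Qed.

End MonomialCorrespondence.

Section FunctionModel.
Variables (F : finFieldType) (C : numClosedFieldType) (chi : F -> C).

Lemma row_eqP d (u v : 'rV[C]_d) :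
  (forall w : 'cV_d, (u *m w) 0 0 = (v *m w) 0 0) -> u = v.
Proof.
by move=> E; apply/rowP=> j; have := E (delta_mx j 0); rewrite -!colE !mxE.
Qed.

(* Modules consist of row vectors, so the basis is made of the evaluations at   *)
(* the points of the model rather than of the delta functions.                  *)
Lemma functional_basis d N (Phi : {linear 'cV[C]_d -> {ffun 'cV[F]_N -> C^o}}) :
  bijective Phi ->
  exists2 ev : 'cV[F]_N -> 'rV[C]_d, basis_family ev &
    forall y v, (ev y *m v) 0 0 = Phi v y.
Proof.
case=> Phi' PhiK Phi'K.
pose ev y : 'rV[C]_d := \row_j Phi (delta_mx j 0) y.
have evE y v : (ev y *m v) 0 0 = Phi v y.
  rewrite [in RHS](matrix_sum_delta v) linear_sum sum_ffunE mxE.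
  apply: eq_bigr => j _; rewrite big_ord1 linearZ !mxE /= ffunE mulrC.
  by rewrite [ord0]ord1.
pose D y := Phi' [ffun y' => (y' == y)%:R].
have DE y y' : Phi (D y) y' = (y' == y)%:R by rewrite Phi'K ffunE.
exists ev => //; split=> [v | c E0 y].
  exists (fun y => (v *m D y) 0 0); apply: row_eqP => w.
  have Ew : w = \sum_y Phi w y *: D y.
    apply: (can_inj PhiK); apply/ffunP=> y; rewrite linear_sum sum_ffunE.
    rewrite (bigD1 y) //= linearZ ffunE DE eqxx big1 ?addr0 => [|z ne].
      by rewrite [_ *: _]mulr1.
    by rewrite linearZ ffunE DE eq_sym (negPf ne) [_ *: _]mulr0.
  rewrite [in LHS]Ew mulmx_sumr mulmx_suml !summxE; apply: eq_bigr => y _.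
  by rewrite -scalemxAr -scalemxAl -evE [LHS]mxE [RHS]mxE mulrC.
have : ((\sum_z c z *: ev z) *m D y) 0 0 = 0 by rewrite E0 mul0mx mxE.
rewrite mulmx_suml summxE (bigD1 y) //= big1 => [|z ne].
  by rewrite addr0 -scalemxAl mxE evE DE eqxx mulr1.
by rewrite -scalemxAl mxE evE DE (negPf ne) mulr0.
Qed.

(** [Y] is half of a free square matrix, so it has rank [N], and multiplying by the invertible [g]
    keeps this rank. It makes the quadratic symbol of the determinant nonzero. *)
Lemma polarization_unit m (A : 'M[F]_m) N (X Y : 'M_(m, N)) (g : glmx F m) b :
  polarization A X Y -> g *m Y = Y *m b -> b \in unitmx.
Proof.
case=> eqm freeXY _ _ E.
have rkY : \rank Y = N.
  have le : (\rank (row_mx X Y) <= N + \rank Y)%N.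
    rewrite -mxrank_tr tr_row_mx -addsmxE.
    rewrite (leq_trans (mxrank_adds_leqif _ _).1) // !mxrank_tr leq_add2r.
    exact: rank_leq_col.
  apply/eqP; rewrite eqn_leq rank_leq_col /= -(leq_add2l N).
  by move: le; have /eqP-> := freeXY; apply: leq_trans; rewrite eqm.
have gfull : row_full (g : 'M[F]_m) by rewrite row_full_unit glvalP.
rewrite -row_full_unit /row_full eqn_leq rank_leq_col /= -[X in (X <= _)%N]rkY.
by rewrite -(eqmxMfull Y gfull) E mxrankM_maxr.
Qed.

Lemma oscillator_basis m (A : 'M[F]_m) d
    (omega : mx_representation C (form_isom A) d) N (X Y : 'M[F]_(m, N)) :
  oscillator chi omega -> polarization A X Y ->
  exists ev : 'cV[F]_N -> 'rV[C]_d,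
  [/\ basis_family ev,
      forall (g : glmx F m) (a b : 'M[F]_N), g \in form_isom A ->
        g *m X = X *m a -> g *m Y = Y *m b ->
        exists2 e, e != 0 & forall y, ev y *m omega g = e *: ev (invmx b *m y) &
      forall (g : glmx F m) (s : 'M[F]_N), g \in form_isom A ->
        g *m X = X -> g *m Y = Y + X *m s ->
        forall y, ev y *m omega g
          = chi (2%:R^-1 * bform A (X *m (s *m y)) (Y *m y)) *: ev y].
Proof.
case=> rho [_ _ _ model] pol; have [Phi [bij _ _ levi shear]] := model _ _ _ pol.
have [ev basis evE] := functional_basis bij.
exists ev; split=> // [g a b Ag gX gY | g s Ag gX gY y].
  exists (quadratic_symbol C (\det b)) => [|y].
    have := polarization_unit pol gY; rewrite unitmxE unitfE /quadratic_symbol.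
    by move/negPf->; case: ifP; rewrite ?oppr_eq0 oner_eq0.
  apply: row_eqP => w; rewrite -mulmxA evE (levi g a b) //.
  by rewrite -scalemxAl mxE evE.
by apply: row_eqP => w; rewrite -mulmxA evE (shear g s) // -scalemxAl mxE evE.
Qed.

End FunctionModel.

(** * Characters, matrices and Kronecker products *)

Section AdditiveCharacters.
Variables (F : finFieldType) (C : numClosedFieldType).

Lemma sum_character_eq0 (theta : F -> C) a :
  {morph theta : x y / x + y >-> x * y} -> theta a != 1 -> \sum_x theta x = 0.
Proof.
move=> hom nt; apply/eqP.
have : \sum_x theta x = theta a * \sum_x theta x.
  rewrite [LHS](reindex_inj (addrI a)) mulr_sumr; apply: eq_bigr => x _.
  by rewrite hom.
move/eqP; rewrite -{1}[\sum_x _]mul1r -subr_eq0 -mulrBl mulf_eq0 subr_eq0 eq_sym.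
by rewrite (negPf nt).
Qed.

Lemma character_opp (chi : F -> C) x :
  nontrivial_character chi -> chi x * chi (- x) = 1.
Proof. by case=> chi0 hom _; rewrite -hom subrr. Qed.

(** If no [c] worked, each product of [chi] with the inverse of [chi0] at a multiple would be a
    nontrivial character, with sum zero. Summed over [c] in the other order, only the term at 0
    survives and gives the order of the field. *)
Lemma character_scale (chi chi0 : F -> C) :
  nontrivial_character chi -> nontrivial_character chi0 ->
  exists2 c, c != 0 & forall x, chi x = chi0 (c * x).
Proof.
move=> chi_nt chi0_nt.
have [chi_0 chiD [x1 nt1]] := chi_nt; have [chi0_0 chi0D [x2 nt2]] := chi0_nt.
have [/existsP[c /forallP Ec] | /existsPn none] :=
  boolP [exists c, [forall x, chi x == chi0 (c * x)]].
  exists c => [|x]; last exact/eqP.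
  apply: contraNneq nt1 => c0; rewrite (eqP (Ec x1)) c0 mul0r chi0_0.
  by [].
have sum0 c : \sum_x chi x * chi0 (- (c * x)) = 0.
  have /forallPn[a nea] := none c; apply: (@sum_character_eq0 _ a).
    by move=> x y /=; rewrite chiD mulrDr opprD chi0D mulrACA.
  apply: contraNneq nea => E1.
  by rewrite -[chi a]mulr1 -(character_opp (c * a) chi0_nt) mulrCA E1 mulr1.
have : \sum_c \sum_x chi x * chi0 (- (c * x)) = #|F|%:R.
  rewrite exchange_big (bigD1 0) //= [X in _ + X]big1 => [|x nzx].
    rewrite addr0 (eq_bigr (fun=> 1)) => [|c _]; last first.
      by rewrite chi_0 mulr0 oppr0 chi0_0 mulr1.
    by rewrite sumr_const.
  (* As a function of [c] the summand is a character; at the witness it takes the value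
     [chi0 x2]. *)
  rewrite -mulr_sumr (@sum_character_eq0 _ (- (x2 / x))) ?mulr0 //.
    by move=> y z /=; rewrite mulrDl opprD chi0D.
  by rewrite mulNr opprK divfK.
rewrite big1 // => /esym/eqP; rewrite pnatr_eq0 => /eqP F0.
by have := card_finRing_gt1 F; rewrite F0.
Qed.

Variable chi : F -> C.
Hypothesis chi_nt : nontrivial_character chi.

Lemma character_inj a b : (forall z, chi (z * a) = chi (z * b)) -> a = b.
Proof.
have [chi_0 chiD [x nt]] := chi_nt => E; apply/eqP; rewrite -subr_eq0.
apply: contraNT nt => nz; have := E (x / (a - b)).
move/(congr1 (fun t => t * chi (- (x / (a - b) * b)))).
by rewrite /= character_opp // -chiD -mulrBr divfK // => ->.
Qed.

(** Stability of [L] under scalars gives equality of the character at all multiples of both traces,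
    which separates them. *)
Lemma character_trace_inj m n (L : pred 'M[F]_(n, m)) (A B : 'M[F]_(m, n)) :
    (forall z S, L S -> L (z *: S)) ->
    (forall S, L S -> chi (\tr (A *m S)) = chi (\tr (B *m S))) ->
  forall S, L S -> \tr (A *m S) = \tr (B *m S).
Proof.
move=> LZ E S LS; apply: character_inj => z.
by have := E _ (LZ z S LS); rewrite -!scalemxAr !linearZ.
Qed.

End AdditiveCharacters.

Section Matrices.
Variable F : fieldType.

Lemma mxtrace_nondegenerate m n (A : 'M[F]_(m, n)) :
  (forall S : 'M_(n, m), \tr (A *m S) = 0) -> A = 0.
Proof.
move=> tr0; apply/matrixP=> i j; rewrite !mxE -[RHS](tr0 (delta_mx j i)).
rewrite /mxtrace (bigD1 i) //= mxE (bigD1 j) //= !mxE !eqxx mulr1 !big1 ?addr0 //.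
  move=> k nek; rewrite mxE big1 // => l _.
  by rewrite mxE (negPf nek) andbF mulr0.
by move=> k nek; rewrite mxE (negPf nek) mulr0.
Qed.

(** Transitivity of the Levi subgroup on matrices of full column rank: it conjugates characters of
    maximal rank and supplies the elements that imitate the smaller group. *)
Lemma complete_left n k (y y' : 'M[F]_(n, k)) :
  \rank y = k -> \rank y' = k -> exists2 a : 'M_n, a \in unitmx & a *m y = y'.
Proof.
move=> ry ry'.
have fy : row_free y^T by rewrite /row_free mxrank_tr ry.
have Ey : y^T *m (pinvmx y^T *m y'^T) = y'^T by rewrite mulmxA mulmxVp // mul1mx.
have [|a ua Ea] := @complete_unitmx _ _ _ y^T (pinvmx y^T *m y'^T).
  by rewrite Ey !mxrank_tr ry ry'.
exists a^T; first by rewrite unitmx_tr.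
by apply: trmx_inj; rewrite trmx_mul trmxK -Ea Ey.
Qed.

Lemma left_inverse_mx n k (y : 'M[F]_(n, k)) :
  \rank y = k -> exists z : 'M_(k, n), z *m y = 1%:M.
Proof.
by move=> ry; exists (pinvmx y); rewrite mulVpmx // /row_full ry.
Qed.

Lemma pid_mx_rank n k : (k <= n)%N -> \rank (pid_mx k : 'M[F]_(n, k)) = k.
Proof. by move=> le; rewrite rank_pid_mx. Qed.

End Matrices.

Section Vectorization.
Variable F : fieldType.

Lemma kron_ord_subproof m k (i : 'I_m) (j : 'I_k) : (i * k + j < m * k)%N.
Proof.
by rewrite (leq_trans (_ : _ < i.+1 * k)%N) ?leq_mul // mulSn addnC ltn_add2r.
Qed.
Definition kron_ord m k (p : 'I_m * 'I_k) : 'I_(m * k) :=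
  Ordinal (kron_ord_subproof p.1 p.2).

Lemma kron_ord_bij m k : bijective (@kron_ord m k).
Proof.
exists (fun l => sval (kron_index l)) => [p|l]; last first.
  by apply: val_inj; rewrite /= -(svalP (kron_index l)).
have := svalP (kron_index (kron_ord p)); move: (sval _) => q /= E.
have k_gt0 : (0 < k)%N by apply: leq_ltn_trans (ltn_ord p.2).
have E2 : q.2 = p.2.
  apply: val_inj => /=; rewrite -[LHS](modn_small (ltn_ord _)).
  by rewrite -[RHS](modn_small (ltn_ord _)) -[LHS](modnMDl q.1) -E modnMDl.
have E1 : q.1 = p.1.
  by apply: val_inj; move/eqP: E; rewrite E2 eqn_add2r eqn_pmul2r // => /eqP/esym.
by rewrite [LHS]surjective_pairing E1 E2 -surjective_pairing.
Qed.

Definition vecm m k (M : 'M[F]_(m, k)) : 'cV[F]_(m * k) :=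
  \col_l M (sval (kron_index l)).1 (sval (kron_index l)).2.
Definition matv m k (v : 'cV[F]_(m * k)) : 'M[F]_(m, k) :=
  \matrix_(i, j) v (kron_ord (i, j)) 0.

Lemma matvK m k : cancel (@matv m k) (@vecm m k).
Proof.
move=> v; apply/colP=> l; rewrite !mxE; congr (v _ _); apply: val_inj.
by rewrite /= -(svalP (kron_index l)).
Qed.

Lemma vecmE m k (M : 'M[F]_(m, k)) p : vecm M (kron_ord p) 0 = M p.1 p.2.
Proof.
rewrite mxE; suff -> : sval (kron_index (kron_ord p)) = p by [].
apply: (bij_inj (kron_ord_bij m k)); apply: val_inj.
by rewrite /= -(svalP (kron_index (kron_ord p))).
Qed.

Lemma vecmK m k : cancel (@vecm m k) (@matv m k).
Proof. by move=> M; apply/matrixP=> i j; rewrite mxE vecmE. Qed.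

Lemma tprod_vecm m n k p (P : 'M[F]_(m, n)) (Q : 'M[F]_(k, p)) (M : 'M[F]_(n, p)) :
  tprod P Q *m vecm M = vecm (P *m M *m Q^T).
Proof.
apply/colP=> l; have [[i j] El] := kron_index l.
have -> : l = kron_ord (i, j) by apply: val_inj.
rewrite vecmE mxE (reindex _ (onW_bij _ (kron_ord_bij n p))) /=.
rewrite (eq_bigr (fun q => P i q.1 * Q j q.2 * M q.1 q.2)) => [|q _]; last first.
  rewrite vecmE; congr (_ * _).
  by apply: tprod_entry.
rewrite -(pair_bigA _ (fun i' j' => P i i' * Q j j' * M i' j')) /= exchange_big.
rewrite mxE; apply: eq_bigr => j' _; rewrite !mxE big_distrl; apply: eq_bigr => i' _.
by rewrite /= mulrAC.
Qed.

Lemma vecm_dot m k (A B : 'M[F]_(m, k)) : ((vecm A)^T *m vecm B) 0 0 = \tr (A^T *m B).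
Proof.
rewrite mxE (reindex _ (onW_bij _ (kron_ord_bij m k))) /=.
rewrite -(pair_bigA _ (fun i j =>
  (vecm A)^T 0 (kron_ord (i, j)) * vecm B (kron_ord (i, j)) 0)) /=.
rewrite exchange_big; apply: eq_bigr => j _; rewrite mxE; apply: eq_bigr => i _.
by rewrite vecmE [_^T _ _]mxE vecmE /= mxE.
Qed.

Lemma tprod_bilinear_trace m k (P : 'M[F]_m) (Q : 'M[F]_k) (M : 'M[F]_(m, k)) :
  ((vecm M)^T *m tprod P Q *m vecm M) 0 0 = \tr (M^T *m P *m M *m Q^T).
Proof. by rewrite -mulmxA tprod_vecm vecm_dot !mulmxA. Qed.

Lemma tprodDl m n k p (A A' : 'M[F]_(m, n)) (B : 'M[F]_(k, p)) :
  tprod (A + A') B = tprod A B + tprod A' B.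
Proof.
apply/matrixP=> i j; rewrite mxE.
have [[i1 i2] /= Ei] := kron_index i; have [[j1 j2] /= Ej] := kron_index j.
by rewrite !(tprod_entry _ _ Ei Ej) mxE mulrDl.
Qed.

Lemma tprodDr m n k p (A : 'M[F]_(m, n)) (B B' : 'M[F]_(k, p)) :
  tprod A (B + B') = tprod A B + tprod A B'.
Proof.
apply/matrixP=> i j; rewrite mxE.
have [[i1 i2] /= Ei] := kron_index i; have [[j1 j2] /= Ej] := kron_index j.
by rewrite !(tprod_entry _ _ Ei Ej) mxE mulrDr.
Qed.

Lemma tprod0l m n k p (B : 'M[F]_(k, p)) : tprod (0 : 'M[F]_(m, n)) B = 0.
Proof. by apply: (addrI (tprod 0 B)); rewrite -tprodDl !addr0. Qed.

Lemma tprod0r m n k p (A : 'M[F]_(m, n)) : tprod A (0 : 'M[F]_(k, p)) = 0.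
Proof. by apply: (addrI (tprod A 0)); rewrite -tprodDr !addr0. Qed.

Lemma tprodNr m n k p (A : 'M[F]_(m, n)) (B : 'M[F]_(k, p)) :
  tprod A (- B) = - tprod A B.
Proof. by apply: (addrI (tprod A B)); rewrite -tprodDr !subrr tprod0r. Qed.

End Vectorization.

(** * The pairs (Sp, O) and (O, Sp) *)

(** Positivity excludes the value 0 of an empty maximum. *)
Lemma bigmax_attained (I : finType) (P : pred I) (G : I -> nat) k :
  (\max_(i | P i) G i)%N = k -> (0 < k)%N -> exists2 i, P i & G i = k.
Proof.
case: (pickP P) => [i0 Pi0 | P0]; last by rewrite big_pred0 // => <-.
by rewrite (bigop.bigmax_eq_arg _ Pi0); case: arg_maxnP => // i Pi _; exists i.
Qed.

Lemma character_occursP (F : finFieldType) (C : numClosedFieldType) (chi : F -> C)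
    n (L : pred 'M[F]_n) (gT : Type) (u : 'M[F]_n -> gT) d (r : gT -> 'M[C]_d) T :
  reflect (exists2 x : 'rV_d, x != 0 &
             forall S, L S -> x *m r (u S) = chi (\tr (T *m S)) *: x)
          (character_occurs chi L u r T).
Proof.
rewrite /character_occurs; set M := bigop.body _ _ _.
apply: (iffP (@rowV0Pn C d d M)).
  by case=> x /sub_bigcapmxP xE nzx; exists x => // S LS; apply/eigenspaceP; apply: xE.
move=> [x nzx xE]; exists x => //.
by apply/sub_bigcapmxP => S LS; apply/eigenspaceP; apply: xE.
Qed.

Lemma basis_family_bij (C : numClosedFieldType) (Y Z : finType) d
    (ev : Y -> 'rV[C]_d) (f : Z -> Y) :
  bijective f -> basis_family ev -> basis_family (ev \o f).
Proof.
move=> bf [span free]; have [g fK gK] := bf; split=> [v | c E0 z].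
  have [c ->] := span v; exists (c \o f).
  by rewrite (reindex f) //; apply: onW_bij.
rewrite -[z]fK; apply: (free (c \o g)); rewrite -[RHS]E0.
by rewrite (reindex f) /=; [apply: eq_bigr => z' _; rewrite fK | apply: onW_bij].
Qed.

Lemma tens_isom (F : finFieldType) m1 m2 (A : 'M[F]_m1) (B : 'M[F]_m2) g h :
  g \in form_isom A -> h \in form_isom B -> tens (g, h) \in form_isom (tprod A B).
Proof.
move=> Ag Bh; have /subsetP/(_ (g, h)) := tens_sub A B.
by rewrite inE Ag Bh => /(_ isT)/morphpreP[].
Qed.

Lemma siegel_trace (R : fieldType) n k (e : R) (S : 'M_n) (y : 'M_(n, k)) (B : 'M_k) :
  \tr (y^T *m (((col_mx 1%:M 0 : 'M_(n + n, n)) *m S)^T *m block_mx 0 1%:M e%:M 0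
          *m (col_mx 0 1%:M : 'M_(n + n, n))) *m y *m B^T)
  = \tr (y *m B *m y^T *m S).
Proof.
rewrite mul_col_mx mul0mx mul1mx tr_col_mx trmx0 mul_row_block mul_row_col.
rewrite !(mulmx0, mul0mx, mulmx1, addr0, add0r).
rewrite -mxtrace_tr !trmx_mul !trmxK.
by rewrite !mulmxA mxtrace_mulC !mulmxA.
Qed.

Lemma levi_mulX (R : fieldType) n (P Q : 'M[R]_n) :
  block_mx P 0 0 Q *m col_mx 1%:M 0 = col_mx 1%:M 0 *m P.
Proof. by rewrite mul_block_col mul_col_mx !(mulmx0, mul0mx, mulmx1, mul1mx, addr0). Qed.

Lemma levi_mulY (R : fieldType) n (P Q : 'M[R]_n) :
  block_mx P 0 0 Q *m col_mx 0 1%:M = col_mx 0 1%:M *m Q.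
Proof. by rewrite mul_block_col mul_col_mx !(mulmx0, mul0mx, mulmx1, mul1mx, add0r). Qed.

Lemma conj_block (R : fieldType) n (a S : 'M[R]_n) : a \in unitmx ->
  block_mx a 0 0 (invmx a)^T *m block_mx 1%:M S 0 1%:M
  = block_mx 1%:M (a *m S *m a^T) 0 1%:M *m block_mx a 0 0 (invmx a)^T.
Proof.
move=> ua; rewrite !mulmx_block !(mulmx0, mul0mx, mulmx1, mul1mx, addr0, add0r).
by rewrite -mulmxA -trmx_mul mulVmx // trmx1 mulmx1.
Qed.

Lemma conj_tr (R : fieldType) n p (e : R) (a : 'M_(p, n)) S :
  S^T = e *: S -> (a *m S *m a^T)^T = e *: (a *m S *m a^T).
Proof.
by move=> trS; rewrite !trmx_mul trmxK trS -!scalemxAl -!scalemxAr mulmxA.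
Qed.

Lemma invmx_eq (R : fieldType) n (P Q : 'M[R]_n) : P *m Q = 1%:M -> invmx P = Q.
Proof.
by move=> PQ; have [uP _] := mulmx1_unit PQ; rewrite -[Q](mulKmx uP) PQ mulmx1.
Qed.

(* Witt's theorem for the image of an injective map. *)
Lemma gram_fiber (R : fieldType) n k (B : 'M[R]_k) (y y0 : 'M_(n, k)) :
  B \in unitmx -> \rank y0 = k -> y *m B *m y^T = y0 *m B *m y0^T ->
  exists2 w, w *m B *m w^T = B & y = y0 *m w.
Proof.
move=> uB ry0 E; have [z zy0] := left_inverse_mx ry0.
have Ew : (z *m y) *m B *m (z *m y)^T = B.
  rewrite trmx_mul -!mulmxA (mulmxA y) (mulmxA (y *m B)) E -!mulmxA.
  by rewrite -trmx_mul zy0 trmx1 mulmx1 mulmxA zy0 mul1mx.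
have ry : \rank y = k.
  apply/eqP; rewrite eqn_leq rank_leq_col /=.
  rewrite -[X in (X <= _)%N](mxrank_unit uB) -{1}Ew -!mulmxA.
  exact: leq_trans (mxrankM_maxr _ _) (mxrankM_maxl _ _).
have [z' z'y] := left_inverse_mx ry.
(* The witness solves the Gram identity for [y]: multiplying on the right by [z'^T] cancels
   [y^T]. *)
have [w defy] : exists w, y = y0 *m w.
  exists (B *m y0^T *m z'^T *m invmx B); rewrite !mulmxA -E -!mulmxA (mulmxA y^T).
  by rewrite -trmx_mul z'y trmx1 mul1mx mulmxV // mulmx1.
have Ezy : z *m y = w by rewrite defy mulmxA zy0 mul1mx.
by exists w; rewrite -?Ezy // Ezy.
Qed.

(* The pair (Sp_2n, O_k) is the case e = -1, and (O_{n,n}, Sp_k) the case e = 1. *)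
Section SiegelPair.
Variables (F : finFieldType) (C : numClosedFieldType) (chi chi0 : F -> C).
Hypothesis oddF : 2%N \notin [pchar F].
Hypothesis chi0_nt : nontrivial_character chi0.
Variable c : F.
Hypothesis nzc : c != 0.
Hypothesis chi_scale : forall x, chi (2%:R^-1 * x) = chi0 (c * x).
Variables (n k : nat) (e : F) (A : 'M[F]_(n + n)) (B : 'M[F]_k) (L : pred 'M[F]_n).
Hypothesis le_kn : (k <= n)%N.
Hypothesis defA : A = block_mx 0 1%:M e%:M 0.
Hypothesis e2 : e * e = 1.
Hypothesis defL : forall S, L S = (S^T == - e *: S).
Hypothesis trB : B^T = - e *: B.
Hypothesis uB : B \in unitmx.
Variables (d : nat) (omega : mx_representation C (form_isom (tprod A B)) d).
Hypothesis osc : oscillator chi omega.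

Local Notation r := (tensor_pair omega).
Local Notation r1 := (res_fst r).
Local Notation r2 := (res_snd r).

(** Each Lagrangian of the first factor is tensored with the whole second factor, so the model lives
    on functions of an [n] by [k] matrix. *)
Let X : 'M[F]_((n + n) * k, n * k) := tprod (col_mx 1%:M 0) 1%:M.
Let Y : 'M[F]_((n + n) * k, n * k) := tprod (col_mx 0 1%:M) 1%:M.

Lemma siegel_polarization : polarization (tprod A B) X Y.
Proof.
have trE (P Q : 'M[F]_(n + n, n)) :
    (tprod P 1%:M)^T *m tprod A B *m tprod Q 1%:M = tprod (P^T *m A *m Q) B.
  by rewrite trmx_tprod -!tprodE trmx1 mul1mx mulmx1.
split; first by rewrite mulnDl.
- apply/row_freeP.
  exists (col_mx (tprod (row_mx 1%:M 0) 1%:M) (tprod (row_mx 0 1%:M) 1%:M)).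
  rewrite mul_row_col -!tprodE mulmx1 -tprodDl !mul_col_row.
  rewrite !(mulmx1, mulmx0, mul0mx) add_block_mx.
  by rewrite !addr0 !add0r -scalar_mx_block tprod1.
- rewrite trE defA tr_col_mx mul_row_block mul_row_col !trmx0 trmx1.
  by rewrite !mul0mx !mulmx0 !mulmx1 !addr0 tprod0l.
rewrite trE defA tr_col_mx mul_row_block mul_row_col !trmx0 trmx1.
by rewrite !mul0mx !mulmx0 !mulmx1 !addr0 tprod0l.
Qed.

Lemma tprod_bform (P Q : 'M[F]_(n + n, n)) y :
  bform (tprod A B) (tprod P 1%:M *m vecm y) (tprod Q 1%:M *m vecm y)
  = \tr (y^T *m (P^T *m A *m Q) *m y *m B^T).
Proof.
rewrite -tprod_bilinear_trace /bform trmx_mul trmx_tprod trmx1.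
have -> : tprod (P^T *m A *m Q) B = tprod P^T 1%:M *m tprod A B *m tprod Q 1%:M.
  by rewrite -!tprodE mul1mx mulmx1.
by rewrite !mulmxA.
Qed.

Lemma siegel_isom S : L S -> siegel S \in form_isom A.
Proof.
rewrite defL => /eqP trS; rewrite inE /= defA tr_block_mx !mulmx_block !trmx0 !trmx1 trS.
rewrite !mul1mx !mulmx1 !mul0mx !mulmx0 !addr0 !add0r.
by rewrite mul_scalar_mx scaleNr addrN mul0mx add0r.
Qed.

Lemma levi_isom (a : glmx F n) : levi a \in form_isom A.
Proof.
rewrite inE /= defA tr_block_mx !mulmx_block !trmx0 trmxK.
rewrite !(mulmx0, mul0mx, addr0, add0r, mulmx1).
rewrite mul_mx_scalar -scalemxAl mulVmx ?glvalP //.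
by rewrite -trmx_mul mulVmx ?glvalP // trmx1 scalemx1.
Qed.

Definition siegel_char (y : 'M[F]_(n, k)) : 'M[F]_n := c *: (y *m B *m y^T).

Lemma siegel_charL y : L (siegel_char y).
Proof.
rewrite defL /siegel_char linearZ /= !trmx_mul trmxK trB -scalemxAl -scalemxAr mulmxA.
by rewrite scalerA mulrC -scalerA.
Qed.

Lemma siegel_basis :
  exists ev : 'M[F]_(n, k) -> 'rV[C]_d,
  [/\ basis_family ev,
      forall S y, L S -> ev y *m r1 (siegel S) = chi0 (\tr (siegel_char y *m S)) *: ev y,
      forall h, h \in form_isom B -> exists2 eps, eps != 0 &
        forall y, ev y *m r2 h = eps *: ev (y *m (invmx h)^T) &
      forall a : glmx F n, exists2 eps, eps != 0 &
        forall y, ev y *m r1 (levi a) = eps *: ev (a^T *m y)].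
Proof.
have [ev [basis act shear]] := oscillator_basis osc siegel_polarization.
exists (fun y => ev (vecm y)); split.
- by apply: (basis_family_bij (f := @vecm F n k)) basis; exists (@matv F n k);
    [apply: vecmK | apply: matvK].
- move=> S y LS; have A1 : (1 : glmx F k)%g \in form_isom B by rewrite group1.
  have -> : r1 (siegel S) = omega (tens (siegel S, 1%g)) by [].
  rewrite (shear (tens (siegel S, 1%g)) (tprod S 1%:M)).
  - rewrite chi_scale (mulmxA X) -tprodE mulmx1 tprod_bform; congr (chi0 _ *: _).
    by rewrite defA siegel_trace /siegel_char -scalemxAl linearZ.
  - by rewrite tens_isom ?siegel_isom.
  - rewrite /= -!tprodE !mulmx1 mul_block_col.
    by rewrite !mulmx0 !mulmx1 !addr0.
  rewrite /= -!tprodE !mulmx1 mul_block_col !mulmx0 !mulmx1 -tprodDl.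
  by rewrite mul_col_mx mul1mx mul0mx add_col_mx !add0r addr0.
- move=> h Bh.
  have comm (P : 'M[F]_(n + n, n)) :
      tens (1%g : glmx F (n + n), h) *m tprod P 1%:M = tprod P 1%:M *m tprod 1%:M h.
    by rewrite /= -!tprodE mul1mx !mulmx1 mul1mx.
  have Tg : tens (1%g, h) \in form_isom (tprod A B) by rewrite tens_isom ?group1.
  have [eps nz E] := act _ _ _ Tg (comm _) (comm _).
  exists eps => // y; have -> : r2 h = omega (tens (1%g, h)) by [].
  rewrite E (@invmx_eq _ _ _ (tprod 1%:M (invmx h))) ?tprod_vecm ?mul1mx //.
  by rewrite -tprodE mulmxV ?glvalP // mulmx1 tprod1.
move=> a.
have gX : tens (levi a, 1%g : glmx F k) *m X = X *m tprod (a : 'M_n) 1%:M.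
  by rewrite /= -!tprodE !mulmx1 levi_mulX.
have gY : tens (levi a, 1%g : glmx F k) *m Y = Y *m tprod (invmx a)^T 1%:M.
  by rewrite /= -!tprodE !mulmx1 levi_mulY.
have Tg : tens (levi a, 1%g) \in form_isom (tprod A B).
  by rewrite tens_isom ?levi_isom ?group1.
have [eps nz E] := act _ _ _ Tg gX gY.
exists eps => // y; have -> : r1 (levi a) = omega (tens (levi a, 1%g)) by [].
rewrite E (@invmx_eq _ _ _ (tprod a^T 1%:M)) ?tprod_vecm ?trmx1 ?mulmx1 //.
by rewrite -tprodE mulmx1 -trmx_mul mulmxV ?glvalP // trmx1 tprod1.
Qed.

(** For arbitrary [M], the matrix [M - e *: M^T] lies in [L], and its trace against [D] is twice
    that of [M]; this is where odd characteristic enters. *)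
Lemma siegel_nondegenerate D :
  L D -> (forall S, L S -> \tr (D *m S) = 0) -> D = 0.
Proof.
move=> LD tr0; apply: mxtrace_nondegenerate => M.
have two : (2%:R : F) != 0 by move: oddF; rewrite inE.
have LS : L (M - e *: M^T).
  rewrite defL linearB linearZ /= trmxK scalerBr scalerA mulNr e2 scaleN1r opprK.
  by rewrite scaleNr addrC.
have := tr0 _ LS; rewrite mulmxBr linearB /= -scalemxAr linearZ /=.
rewrite -[\tr (D *m M^T)]mxtrace_tr trmx_mul trmxK mxtrace_mulC.
move: LD; rewrite defL => /eqP->; rewrite -scalemxAr linearZ /= mulrA mulrN e2 mulN1r.
by rewrite opprK -mulr2n -mulr_natl => /eqP; rewrite mulf_eq0 (negPf two) => /eqP.
Qed.

Lemma levi_siegel (a : glmx F n) S :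
  (levi a * siegel S)%g = (siegel (a *m S *m a^T) * levi a)%g.
Proof.
by apply: val_inj; rewrite /= conj_block // glvalP.
Qed.

Lemma siegelL_conj (a : 'M_n) S : L S -> L (a *m S *m a^T).
Proof.
by rewrite !defL => /eqP trS; apply/eqP; apply: conj_tr.
Qed.

(** A left inverse of [y] recovers the invertible matrix [c *: B] from the Gram matrix. *)
Lemma siegel_char_rank y : (\rank (siegel_char y) == k) = (\rank y == k).
Proof.
have le : (\rank (siegel_char y) <= \rank y <= k)%N.
  rewrite rank_leq_col andbT /siegel_char -!mulmxA.
  by apply: leq_trans (mxrank_scale _ _) _; apply: mxrankM_maxl.
apply/eqP/eqP=> [E | ry]; first by apply/eqP; rewrite eqn_leq andbC -[X in (X <= _)%N]E.
case/andP: le => le1 le2; apply/eqP; rewrite eqn_leq (leq_trans le1) //=.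
have [z zy] := left_inverse_mx ry.
have : \rank (c *: B) = k by rewrite mxrank_scale_nz // mxrank_unit.
have -> : c *: B = z *m (siegel_char y *m z^T).
  rewrite /siegel_char -scalemxAl -scalemxAr -!mulmxA -trmx_mul zy trmx1 mulmx1.
  by rewrite mulmxA zy mul1mx.
by move=> {1}<-; apply: leq_trans (mxrankM_maxr _ _) (mxrankM_maxl _ _).
Qed.

Lemma siegel_char_inj y y' :
  (forall S, L S -> chi0 (\tr (siegel_char y *m S)) = chi0 (\tr (siegel_char y' *m S))) ->
  siegel_char y = siegel_char y'.
Proof.
move=> E; apply/eqP; rewrite -subr_eq0; apply/eqP; apply: siegel_nondegenerate.
  rewrite defL linearB /= scalerBr; move: (siegel_charL y) (siegel_charL y').
  by rewrite !defL => /eqP-> /eqP->.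
move=> S LS; rewrite mulmxBl linearB /=; apply/eqP; rewrite subr_eq0; apply/eqP.
apply: (character_trace_inj chi0_nt (L := L)) S LS => // z S LS.
by move: LS; rewrite !defL => /eqP LS; rewrite linearZ /= LS !scalerA mulrC.
Qed.

Section WithBasis.
Variable ev : 'M[F]_(n, k) -> 'rV[C]_d.
Hypothesis basis : basis_family ev.
Hypothesis evU : forall S y, L S ->
  ev y *m r1 (siegel S) = chi0 (\tr (siegel_char y *m S)) *: ev y.
Hypothesis evO : forall h, h \in form_isom B -> exists2 eps, eps != 0 &
  forall y, ev y *m r2 h = eps *: ev (y *m (invmx h)^T).
Hypothesis evL : forall a : glmx F n, exists2 eps, eps != 0 &
  forall y, ev y *m r1 (levi a) = eps *: ev (a^T *m y).

Lemma siegel_support (v : 'rV_d) T : L T -> v != 0 ->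
  (forall S, L S -> v *m r1 (siegel S) = chi0 (\tr (T *m S)) *: v) ->
  exists y, T = siegel_char y.
Proof.
move=> LT nzv vE; have [cv [Ev [y nzy]]] := basis_support basis nzv.
exists y; apply/eqP; rewrite -subr_eq0; apply/eqP; apply: siegel_nondegenerate.
  rewrite defL linearB /= scalerBr; move: LT (siegel_charL y).
  by rewrite !defL => /eqP-> /eqP->.
move=> S LS; rewrite mulmxBl linearB /=; apply/eqP; rewrite subr_eq0 eq_sym; apply/eqP.
apply: (character_trace_inj chi0_nt (L := L)) S LS => [z S LS | S LS].
  by move: LS; rewrite !defL => /eqP LS; rewrite linearZ /= LS !scalerA mulrC.
have := eigen_support (A := r1 (siegel S))
  (lam := fun y => chi0 (\tr (siegel_char y *m S))) basis _ _ nzy.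
by apply=> [z|]; [apply: evU | rewrite -Ev vE].
Qed.

Variable y0 : 'M[F]_(n, k).
Hypothesis ry0 : \rank y0 = k.

Definition siegel_group : {set glmx F (n + n)} := [set siegel S | S in L].
Definition siegel_psi (y : 'M[F]_(n, k)) (u : glmx F (n + n)) : C :=
  chi0 (\tr (siegel_char y *m ursubmx (u : 'M_(n + n)))).

Lemma siegel_weightP p (v : 'M_(p, d)) :
  weight_space r siegel_group (siegel_psi y0) v <->
  forall S, L S -> v *m r1 (siegel S) = chi0 (\tr (siegel_char y0 *m S)) *: v.
Proof.
split=> [wv S LS | wv _ /imsetP[S LS ->]].
  have /wv -> : siegel S \in siegel_group by apply: imset_f.
  by rewrite /siegel_psi /= block_mxKur.
by rewrite wv // /siegel_psi /= block_mxKur.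
Qed.

Section Subrepresentation.
Variables (m : nat) (pi : mx_representation C (form_isom A) m) (f : 'M[C]_(m, d)).
Hypothesis ff : row_free f.
Hypothesis hf : intertwines pi r1 f.

Lemma siegel_occurs T : L T -> character_occurs chi0 L (@siegel F n) pi T ->
  exists2 x : 'rV_m, x != 0 & exists2 y, T = siegel_char y &
    forall S, L S -> x *m f *m r1 (siegel S) = chi0 (\tr (siegel_char y *m S)) *: (x *m f).
Proof.
move=> LT /character_occursP[x nzx xE]; exists x => //.
have xfE S : L S -> x *m f *m r1 (siegel S) = chi0 (\tr (T *m S)) *: (x *m f).
  by move=> LS; rewrite -mulmxA -hf ?siegel_isom // mulmxA xE // scalemxAl.
have [|y Ey] := siegel_support LT _ xfE; first by rewrite mulmx_free_eq0.
by exists y => // S LS; rewrite xfE // Ey.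
Qed.

Lemma siegel_rank_le : (rank_wrt chi0 L L (@siegel F n) pi <= k)%N.
Proof.
apply/bigmax_leqP => T /andP[LT /(siegel_occurs LT)[x _ [y -> _]]].
rewrite /siegel_char -!mulmxA; apply: leq_trans (mxrank_scale _ _) _.
exact: leq_trans (mxrankM_maxl _ _) (rank_leq_col _).
Qed.

(** A character of rank [k] comes from a point of rank [k], and the Levi subgroup moves that point
    to [y0]. *)
Lemma siegel_rank_weight : (0 < m)%N ->
  rank_wrt chi0 L L (@siegel F n) pi = k <->
  exists2 x : 'rV_m, x != 0 & weight_space r siegel_group (siegel_psi y0) (x *m f).
Proof.
move=> m_gt0; split=> [rk | [x nzx /siegel_weightP wx]]; last first.
  apply/eqP; rewrite eqn_leq siegel_rank_le /= /rank_wrt.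
  have /eqP <- : \rank (siegel_char y0) == k by rewrite siegel_char_rank ry0.
  apply: leq_bigmax_cond; rewrite siegel_charL; apply/character_occursP.
  exists x => // S LS; apply: (row_free_inj ff).
  by rewrite -mulmxA hf ?siegel_isom // mulmxA wx // scalemxAl.
(* For [k = 0] the model has a single point, so every vector is a weight vector. *)
have [k0 | k_gt0] := posnP k.
  have /rV0Pn : (delta_mx 0 (Ordinal m_gt0) : 'rV[C]_m) != 0.
    apply/rV0Pn; exists (Ordinal m_gt0); rewrite mxE !eqxx; exact: oner_neq0.
  move=> /rV0Pn nzx; exists (delta_mx 0 (Ordinal m_gt0)) => //.
  apply/siegel_weightP => S LS; have [cv ->] := basis.1 (delta_mx 0 (Ordinal m_gt0) *m f).
  rewrite mulmx_suml scaler_sumr; apply: eq_bigr => y _.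
  rewrite -scalemxAl evU // !scalerA mulrC; congr (chi0 (\tr (siegel_char _ *m _)) * _ *: _).
  by apply/matrixP=> i j; have := ltn_ord j; rewrite {2}k0.
have [T /andP[LT occ] rT] := bigmax_attained rk k_gt0.
have [x nzx [y Ey xE]] := siegel_occurs LT occ.
have ry : \rank y = k by apply/eqP; rewrite -siegel_char_rank -Ey rT.
have [a ua Ea] := complete_left ry ry0.
have uaT : a^T \in unitmx by rewrite unitmx_tr.
pose b := GLmx uaT.
exists (x *m pi (levi b)).
  by rewrite mulmx_free_eq0 // row_free_unit repr_mx_unit ?levi_isom.
apply/siegel_weightP => S LS.
rewrite -(mulmxA x) hf ?levi_isom // mulmxA -mulmxA -repr_mxM ?levi_isom ?siegel_isom //.
rewrite levi_siegel repr_mxM ?levi_isom ?siegel_isom ?siegelL_conj //.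
rewrite mulmxA xE ?siegelL_conj // -scalemxAl; congr (chi0 _ *: _).
rewrite /= trmxK /siegel_char -Ea trmx_mul -!scalemxAl !linearZ /=; congr (_ * _).
by rewrite !mulmxA mxtrace_mulC !mulmxA.
Qed.

End Subrepresentation.

Lemma siegel_correspondence :
  exists2 eta, eta_correspondence r
      (fun _ pi => rank_wrt chi0 L L (@siegel F n) pi = k) eta &
    forall j, exists f, row_free f /\ intertwines (irr_repr (eta j)) r1 f.
Proof.
have [eps epsE] : exists eps : glmx F k -> C, forall h, h \in form_isom B ->
    eps h != 0 /\ forall y, ev y *m r2 h = eps h *: ev (y *m (invmx h)^T).
  apply: (@fin_all_exists _ (fun=> C) (fun h e1 => h \in form_isom B ->
    e1 != 0 /\ forall y, ev y *m r2 h = e1 *: ev (y *m (invmx h)^T))) => h.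
  have [Bh|_] := boolP (h \in form_isom B); last by exists 0.
  by have [e1 nz E] := evO Bh; exists e1.
apply: (@monomial_correspondence _ _ _ _ _ _ r _ ev siegel_group siegel_psi y0
          (fun h => y0 *m (invmx h)^T) eps) => //.
- by apply/subsetP => _ /imsetP[S LS ->]; apply: siegel_isom.
- by move=> y _ /imsetP[S LS ->]; rewrite evU // /siegel_psi /= block_mxKur.
- by move=> h /epsE[].
- by move=> h /epsE[_ ->].
- move=> h h' _ _ E; have [z zy0] := left_inverse_mx ry0.
  have := congr1 (mulmx z) E; rewrite !mulmxA zy0 !mul1mx => /trmx_inj Eh.
  by apply: val_inj; rewrite /= -[val h]invmxK [invmx (val h)]Eh invmxK.
- move=> y Ey.
  have /(congr1 (fun M => c^-1 *: M)) : siegel_char y = siegel_char y0.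
    apply: siegel_char_inj => S LS.
    by have := Ey _ (imset_f _ LS); rewrite /siegel_psi /= block_mxKur.
  rewrite /siegel_char !scalerA mulVf // !scale1r => Ey'.
  have [w wB ->] := gram_fiber uB ry0 Ey'.
  have uw : w \in unitmx.
    have : w *m B *m w^T \in unitmx by rewrite wB.
    by rewrite !unitmx_mul => /andP[/andP[]].
  (* Points transform by the inverse transpose of [h], so the isometry [w] comes from this [h]. *)
  have uwT : invmx w^T \in unitmx by rewrite unitmx_inv unitmx_tr.
  exists (GLmx uwT); last by rewrite /= invmxK trmxK.
  rewrite inE /= -[in X in X == _]wB trmx_inv trmxK !mulmxA mulVmx // mul1mx.
  by rewrite -mulmxA mulmxV ?unitmx_tr // mulmx1.
- move=> h Bh.
  have rh : \rank (y0 *m (invmx h)^T) = k.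
    by rewrite mxrankMfree // row_free_unit unitmx_tr unitmx_inv glvalP.
  have [a ua Ea] := complete_left ry0 rh.
  have uaT : a^T \in unitmx by rewrite unitmx_tr.
  have [e1 nz E] := evL (GLmx uaT).
  by exists (levi (GLmx uaT)), e1; rewrite levi_isom E /= trmxK Ea.
move=> m pi f irr ff hf; apply: siegel_rank_weight => //.
by case/mx_irrP: irr.
Qed.

End WithBasis.

(** For the type: a rank [k] character in any subrepresentation is [c *: (y *m B *m y^T)] with [y]
    of rank [k], a copy of the form [c *: B]. It applies to omega and, through their embeddings, to
    the values of eta. *)
Lemma siegel_pair :
  [/\ rank_wrt chi0 L L (@siegel F n) r1 = k,
      forall T, L T -> \rank T = k -> character_occurs chi0 L (@siegel F n) r1 T ->
        same_type T (c *: B) &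
      exists2 eta, eta_correspondence r
          (fun _ pi => rank_wrt chi0 L L (@siegel F n) pi = k) eta &
        forall j T, L T -> \rank T = k ->
          character_occurs chi0 L (@siegel F n) (irr_repr (eta j)) T ->
        same_type T (c *: B)].
Proof.
have [ev [basis evU evO evL]] := siegel_basis.
pose y0 : 'M[F]_(n, k) := pid_mx k.
have ry0 : \rank y0 = k by apply: pid_mx_rank.
have typ m (pi : mx_representation C (form_isom A) m) f T :
    row_free f -> intertwines pi r1 f -> L T -> \rank T = k ->
    character_occurs chi0 L (@siegel F n) pi T -> same_type T (c *: B).
  move=> ff hf LT rT occ.
  have [x _ [y Ey _]] := siegel_occurs basis evU ff hf LT occ.
  exists y; first by apply/eqP; rewrite -siegel_char_rank -Ey rT.
  by rewrite Ey /siegel_char -scalemxAr -scalemxAl.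
have free1 : row_free (1%:M : 'M[C]_d) by rewrite row_free_unit unitmx1.
have hom1 : intertwines r1 r1 1%:M by move=> g _; rewrite mulmx1 mul1mx.
have [eta eta_corr emb] := siegel_correspondence basis evU evO evL ry0.
have nz0 : ev y0 != 0 by apply: basis_neq0.
split.
(* The rank of omega itself is the case of the identity embedding; the nonzero row [ev y0] shows
   that [d] is positive. *)
- apply/(siegel_rank_weight basis evU ry0 free1 hom1).
    by rewrite lt0n; apply: contraNneq nz0 => d0; apply/eqP/rowP=> i;
       have := ltn_ord i; rewrite {2}d0.
  exists (ev y0) => //; apply/siegel_weightP => S LS.
  by rewrite mulmx1 evU.
- by move=> T; apply: typ free1 hom1.
exists eta => // j T; have [f [ff hf]] := emb j; exact: typ ff hf.
Qed.

End SiegelPair.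

(** * The pair (GL, GL) *)

(* A polarization of V + V^*: X takes the coordinates selected by D from V and   *)
(* those selected by E from V^*; Y takes the complementary ones.                *)
Section MixedPolarization.
Variables (R : fieldType) (N : nat) (D E : 'M[R]_N).
Hypotheses (DD : D *m D = D) (EE : E *m E = E) (DE : D *m E = 0) (ED : E *m D = 0).
Hypotheses (trD : D^T = D) (trE : E^T = E) (DE1 : D + E = 1%:M).

Local Notation X := (col_mx D E).
Local Notation Y := (col_mx E D).
Local Notation J := (block_mx 0 1%:M (- 1%:M) 0).

Lemma mixed_free : row_free (row_mx X Y).
Proof.
apply/row_freeP; exists (row_mx X Y); rewrite -block_mxEh mulmx_block.
by rewrite DD EE DE ED !addr0 [E + D]addrC DE1 -scalar_mx_block.
Qed.

Lemma mixed_isotropic : X^T *m J *m X = 0 /\ Y^T *m J *m Y = 0.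
Proof.
split; rewrite tr_col_mx trE trD mul_row_block !(mulmx0, mulmxN, mulmx1) add0r addr0;
  by rewrite mul_row_col mulNmx DE ED !(oppr0, addr0).
Qed.

Lemma idem_compl_comm G : G *m D = D *m G -> G *m E = E *m G.
Proof.
have -> : E = 1%:M - D by rewrite -DE1 [D + E]addrC addrK.
by move=> cG; rewrite mulmxBr mulmxBl mulmx1 mul1mx cG.
Qed.

Lemma mixed_levi G G' : G *m D = D *m G -> G' *m D = D *m G' ->
  block_mx G 0 0 G' *m X = X *m (G *m D + G' *m E) /\
  block_mx G 0 0 G' *m Y = Y *m (G *m E + G' *m D).
Proof.
move=> cG cG'; have cGE := idem_compl_comm cG; have cG'E := idem_compl_comm cG'.
rewrite !mul_block_col !mul_col_mx !mul0mx !addr0 !add0r !mulmxDr !mulmxA.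
rewrite -cG -cG' -cGE -cG'E -!(mulmxA G) -!(mulmxA G') DD EE DE ED.
by rewrite !mulmx0 !addr0 !add0r.
Qed.

Lemma mixed_levi_inv G G' H H' :
    H *m D = D *m H -> H' *m D = D *m H' ->
    G *m H = 1%:M -> G' *m H' = 1%:M ->
  (G *m E + G' *m D) *m (H *m E + H' *m D) = 1%:M.
Proof.
move=> cH cH' GH GH'; have cHE := idem_compl_comm cH.
rewrite cHE cH' mulmxDl !mulmxDr -!(mulmxA G) -!(mulmxA G') !(mulmxA E) !(mulmxA D).
rewrite EE DD ED DE !mul0mx !mulmx0 add0r addr0 -cHE -cH' !mulmxA GH GH' !mul1mx.
by rewrite addrC.
Qed.

Variable M : 'M[R]_N.
Hypotheses (MD : M *m D = M) (DM : D *m M = 0).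

Let MtD : M^T *m D = 0. Proof. by rewrite -trD -trmx_mul DM trmx0. Qed.
Let DMt : D *m M^T = M^T. Proof. by rewrite -{1}trD -trmx_mul MD. Qed.
Let ME : M *m E = 0. Proof. by rewrite -MD -mulmxA DE mulmx0. Qed.
Let MtE : M^T *m E = M^T. Proof. by rewrite -[RHS]mulmx1 -DE1 mulmxDr MtD add0r. Qed.
Let EM : E *m M = M. Proof. by rewrite -[RHS]mul1mx -DE1 mulmxDl DM add0r. Qed.
Let EMt : E *m M^T = 0. Proof. by rewrite -DMt mulmxA ED mul0mx. Qed.

(** [M] sends the [D]-coordinates to the [E]-coordinates, so [1%:M - M^T] and its contragredient
    together form one shear of the mixed polarization. *)
Lemma mixed_shear :
  block_mx (1%:M - M^T) 0 0 (1%:M + M) *m X = X /\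
  block_mx (1%:M - M^T) 0 0 (1%:M + M) *m Y = Y + X *m (M - M^T).
Proof.
split; rewrite mul_block_col !mul0mx addr0 add0r.
  by rewrite mulmxBl mulmxDl !mul1mx MtD ME subr0 addr0.
rewrite mul_col_mx add_col_mx !mulmxBr mulmxBl mulmxDl !mul1mx.
by rewrite MtE MD DM DMt EM EMt subr0 sub0r.
Qed.

(** The parts [M] and [M^T] contribute equal scalars, being transposes of each other. This cancels
    the one half and leaves a sign, whence the normalization [chi_opp]. *)
Lemma mixed_bform (w : 'cV[R]_N) : (2%:R : R) != 0 ->
  2%:R^-1 * ((X *m ((M - M^T) *m w))^T *m J *m (Y *m w)) 0 0 = - (w^T *m M *m w) 0 0.
Proof.
move=> two.
have -> : (X *m ((M - M^T) *m w))^T *m J *m (Y *m w)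
        = - (w^T *m M *m w) - (w^T *m M *m w)^T.
  rewrite !trmx_mul tr_col_mx trE trD linearB /= trmxK -!mulmxA.
  rewrite (mulmxA J) mul_block_col !mul0mx mul1mx mulNmx mul1mx add0r addr0.
  rewrite (mulmxA (row_mx _ _)) mul_row_col mulmxN DD EE.
  have Ms : (M^T - M) *m (D - E) = - M - M^T.
    by rewrite mulmxBr !mulmxBl MtE ME MtD MD sub0r subr0.
  rewrite (mulmxA (M^T - M)) Ms mulmxBl mulmxBr !mulNmx mulmxN.
  by rewrite trmxK.
have -> (a : 'M[R]_1) : (- a - a^T) 0 0 = - (2%:R * a 0 0).
  by rewrite !mxE -opprD -mulr2n mulr_natl.
by rewrite mulrN mulKf.
Qed.

End MixedPolarization.

Lemma vecmD (R : fieldType) m k (M M' : 'M[R]_(m, k)) :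
  vecm (M + M') = vecm M + vecm M'.
Proof. by apply/colP=> l; rewrite !mxE. Qed.

Lemma idem_compl (R : fieldType) n (Q : 'M[R]_n) : Q *m Q = Q ->
  [/\ (1%:M - Q) *m (1%:M - Q) = 1%:M - Q, Q *m (1%:M - Q) = 0 &
      (1%:M - Q) *m Q = 0].
Proof.
move=> QQ; have QE : Q *m (1%:M - Q) = 0 by rewrite mulmxBr mulmx1 QQ subrr.
split=> //; first by rewrite mulmxBl mul1mx QE subr0.
by rewrite mulmxBl mul1mx QQ subrr.
Qed.

Lemma comm_invmx (R : fieldType) n (h Q : 'M[R]_n) :
  h \in unitmx -> h *m Q = Q *m h -> invmx h *m Q = Q *m invmx h.
Proof.
by move=> uh cQ; rewrite -{1}(mulmxK uh Q) -cQ !mulmxA mulVmx // mul1mx.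
Qed.

Lemma invmx_tprod (R : fieldType) m k (P : 'M[R]_m) (Q : 'M[R]_k) :
  P \in unitmx -> Q \in unitmx -> invmx (tprod P Q) = tprod (invmx P) (invmx Q).
Proof.
by move=> uP uQ; apply: invmx_eq; rewrite -tprodE !mulmxV // tprod1.
Qed.

(** * Standard matrix subgroups through idempotents *)

Section BlockProjections.
Variables (F : finFieldType) (n : nat).
Implicit Types (a : {ffun 'I_n -> 'I_n.+1}) (j l : 'I_n).

Definition block_proj a j : 'M[F]_n := diag_mx (\row_i (in_block a j i)%:R).

Lemma block_proj_idem a j : block_proj a j *m block_proj a j = block_proj a j.
Proof.
apply/matrixP=> i1 i2; rewrite mul_diag_mx !mxE; case: in_block; rewrite ?mul1r //.
by rewrite !mul0r mul0rn.
Qed.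

Lemma block_proj_tr a j : (block_proj a j)^T = block_proj a j.
Proof. exact: tr_diag_mx. Qed.

Lemma in_block_disjoint a j l i : (j < l)%N -> in_block a j i -> ~~ in_block a l i.
Proof.
move=> lt_jl /andP[_ lt_i]; rewrite negb_and -ltnNge; apply/orP; left.
apply: leq_trans lt_i _; rewrite [X in (_ <= X)%N](bigD1 j) //= addnC leq_add2l.
rewrite big_mkcond [X in (_ <= X)%N]big_mkcond leq_sum //= => j' _.
case: ifP => // lt_j'j; rewrite (ltn_trans lt_j'j lt_jl) /=.
by rewrite (_ : j' != j) //; apply: contraTneq lt_j'j => ->; rewrite ltnn.
Qed.

Lemma block_proj_disjoint a j l : (j < l)%N -> block_proj a j *m block_proj a l = 0.
Proof.
move=> lt_jl; apply/matrixP=> i1 i2; rewrite mul_diag_mx !mxE.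
have [Ei|] := eqVneq i1 i2; last by rewrite mulr0n mulr0.
have [/(in_block_disjoint lt_jl)/negPf | _] := boolP (in_block a j i1).
  by rewrite mul1r => ->; rewrite mul0rn.
by rewrite mul0r.
Qed.

Lemma block_supportedE a j l (S : 'M[F]_n) :
  block_supported a j l S = (block_proj a j *m S *m block_proj a l == S).
Proof.
have PSQ i1 i2 : (block_proj a j *m S *m block_proj a l) i1 i2
    = (in_block a j i1)%:R * S i1 i2 * (in_block a l i2)%:R.
  by rewrite mul_mx_diag mul_diag_mx !mxE.
apply/forallP/eqP=> [supp | ES i1].
  apply/matrixP=> i1 i2; rewrite PSQ; have := forallP (supp i1) i2.
  have [-> _|_ /andP[-> ->]] := eqVneq (S i1 i2) 0; first by rewrite mulr0 mul0r.
  by rewrite mul1r mulr1.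
apply/forallP=> i2; apply/implyP; rewrite -ES PSQ.
by do 2!case: in_block; rewrite ?mulr0 ?mul0r ?eqxx.
Qed.

End BlockProjections.

Lemma square_zero_inv (R : fieldType) n (S : 'M[R]_n) :
  S *m S = 0 -> (1%:M + S) *m (1%:M - S) = 1%:M.
Proof. by move=> SS; rewrite mulmxBr mulmx1 mulmxDl mul1mx SS addr0 addrK. Qed.

Lemma square_zero_unit (R : fieldType) n (S : 'M[R]_n) :
  S *m S = 0 -> 1%:M + S \in unitmx.
Proof. by move/square_zero_inv/mulmx1_unit=> []. Qed.

Lemma unipotentE (F : finFieldType) n (S : 'M[F]_n) :
  S *m S = 0 -> unipotent S = 1%:M + S :> 'M_n.
Proof. by move=> SS; rewrite /unipotent insubdK // -topredE /= square_zero_unit. Qed.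

Section GLPair.
Variables (F : finFieldType) (C : numClosedFieldType) (chi chi0 : F -> C).
Hypothesis oddF : 2%N \notin [pchar F].
Hypothesis chi0_nt : nontrivial_character chi0.
Variable c : F.
Hypothesis nzc : c != 0.
Hypothesis chi_opp : forall x, chi (- x) = chi0 (c * x).
Variables (k n d : nat).
Variable omega : mx_representation C (form_isom (sympl_form F (k * n))) d.
Hypothesis osc : oscillator chi omega.

Local Notation r := (@gl_dual_pair F C n k d omega).
Local Notation r1 := (res_fst r).
Local Notation r2 := (res_snd r).

Section Model.
Variable Q : 'M[F]_n.
Hypotheses (QQ : Q *m Q = Q) (trQ : Q^T = Q).

Let D : 'M[F]_(k * n) := tprod 1%:M Q.
Let E : 'M[F]_(k * n) := tprod 1%:M (1%:M - Q).

Let DD : D *m D = D. Proof. by rewrite -tprodE mul1mx QQ. Qed.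
Let EE : E *m E = E.
Proof. by have [EE _ _] := idem_compl QQ; rewrite -tprodE mul1mx EE. Qed.
Let DE : D *m E = 0.
Proof. by have [_ QE _] := idem_compl QQ; rewrite -tprodE QE tprod0r. Qed.
Let ED : E *m D = 0.
Proof. by have [_ _ EQ] := idem_compl QQ; rewrite -tprodE EQ tprod0r. Qed.
Let trD : D^T = D. Proof. by rewrite trmx_tprod trmx1 trQ. Qed.
Let trE : E^T = E. Proof. by rewrite trmx_tprod linearB /= !trmx1 trQ. Qed.
Let DE1 : D + E = 1%:M. Proof. by rewrite -tprodDr [Q + _]addrC subrK tprod1. Qed.

Lemma mixed_polarization : polarization (sympl_form F (k * n)) (col_mx D E) (col_mx E D).
Proof.
have [iX iY] := mixed_isotropic DE ED trD trE.
by split => //; apply: mixed_free DD EE DE ED DE1.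
Qed.

(** A point [y] holds matrix entries in the columns outside [Q] and dual entries in those of [Q].
    With this choice the unipotent elements mapping the range of [Q] to its complement act by
    multiplication operators. *)
Lemma gl_model :
  exists ev : 'M[F]_(k, n) -> 'rV[C]_d,
  [/\ basis_family ev,
      forall (u : glmx F n) (S : 'M[F]_n) y, u = 1%:M + S :> 'M_n ->
        S *m Q = S -> Q *m S = 0 ->
        ev y *m r1 u = chi0 (c * \tr (y^T *m y *m S)) *: ev y &
      forall (h : glmx F n) (g : glmx F k), h *m Q = Q *m h :> 'M_n ->
        exists2 eps, eps != 0 & forall y, ev y *m r (h, g)
          = eps *: ev (invmx g *m y *m (1%:M - Q) *m h + g^T *m y *m Q *m (invmx h)^T)].
Proof.
have [ev [basis act shear]] := oscillator_basis osc mixed_polarization.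
exists (fun y => ev (vecm y)); split.
- by apply: (basis_family_bij (f := @vecm F k n)) basis; exists (@matv F k n);
    [apply: vecmK | apply: matvK].
- move=> u S y Eu SQ QS.
  pose M := tprod (1%:M : 'M[F]_k) S.
  have MD : M *m D = M by rewrite -tprodE mul1mx SQ.
  have DM : D *m M = 0 by rewrite -tprodE QS tprod0r.
  have SS : S *m S = 0 by rewrite -{1}SQ -mulmxA QS mulmx0.
  have MM : M *m M = 0 by rewrite -tprodE SS tprod0r.
  have Eu' : invmx u = 1%:M - S by apply: invmx_eq; rewrite Eu square_zero_inv.
  pose G := tens (1%g : glmx F k, contragredient u).
  have EG : G = 1%:M - M^T :> 'M_(k * n).
    by rewrite /= Eu' linearB /= trmx1 tprodDr tprodNr tprod1 /M trmx_tprod trmx1.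
  have EG' : (invmx G)^T = 1%:M + M.
    have -> : invmx G = 1%:M + M^T.
      apply: invmx_eq; rewrite EG mulmxDr mulmx1 mulmxBl mul1mx -trmx_mul MM trmx0.
      by rewrite subr0 subrK.
    by rewrite linearD /= trmx1 trmxK.
  have EL : levi G = block_mx (1%:M - M^T) 0 0 (1%:M + M) :> 'M_(k * n + k * n).
    by rewrite -EG -EG'.
  have -> : r1 u = omega (levi G) by [].
  have [gX gY] := mixed_shear DE ED trD DE1 MD DM.
  rewrite (shear _ (M - M^T)) ?levi_form_isom //; last 2 first.
  - by rewrite EL.
  - by rewrite EL.
  have two : (2%:R : F) != 0 by move: oddF; rewrite inE.
  rewrite /bform (mixed_bform DD EE DE trD trE DE1 MD DM) // chi_opp.
  rewrite tprod_bilinear_trace mulmx1 -mxtrace_tr !trmx_mul !trmxK.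
  by rewrite mxtrace_mulC.
move=> h g hQ.
pose T := tens (g, contragredient h).
have uh := glvalP h; have ug := glvalP g.
have ET : invmx T = tprod (invmx g) (h : 'M_n)^T.
  by rewrite /= invmx_tprod ?unitmx_tr ?unitmx_inv // -trmx_inv invmxK.
have hQV := comm_invmx uh hQ.
have QhT : Q *m (h : 'M_n)^T = (h : 'M_n)^T *m Q.
  by rewrite -{1}trQ -trmx_mul hQ trmx_mul trQ.
have QhVT : Q *m (invmx h)^T = (invmx h)^T *m Q.
  by rewrite -{1}trQ -trmx_mul hQV trmx_mul trQ.
have cT : T *m D = D *m T by rewrite /= -!tprodE mul1mx mulmx1 QhVT.
have cT' : (invmx T)^T *m D = D *m (invmx T)^T.
  by rewrite ET trmx_tprod trmxK -!tprodE mul1mx mulmx1 hQ.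
have [gX gY] := mixed_levi DD EE DE ED DE1 cT cT'.
have [eps nz Eeps] := act (levi T) _ _ (levi_form_isom T) gX gY.
exists eps => // y; rewrite -[r (h, g)]/(omega (levi T)) Eeps; congr (_ *: ev _).
have cH : invmx T *m D = D *m invmx T.
  by rewrite ET -!tprodE mul1mx mulmx1 QhT.
have cH' : tprod g^T (invmx h) *m D = D *m tprod g^T (invmx h).
  by rewrite -!tprodE mul1mx mulmx1 hQV.
rewrite (invmx_eq (mixed_levi_inv DD EE DE ED DE1 cH cH' _ _)); first 1 last.
- by rewrite mulmxV ?glvalP.
- rewrite ET trmx_tprod trmxK -tprodE -trmx_mul mulmxV // mulmxV // trmx1.
  by rewrite tprod1.
rewrite ET -!tprodE !mulmx1 mulmxDl !tprod_vecm -vecmD; congr (vecm (_ + _)).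
  by rewrite trmx_mul trmxK linearB /= trmx1 trQ mulmxA.
by rewrite trmx_mul trQ mulmxA.
Qed.

End Model.
Section Support.
Variables P Q : 'M[F]_n.
Hypotheses (PP : P *m P = P) (trP : P^T = P) (QQ : Q *m Q = Q) (trQ : Q^T = Q).
Hypothesis PQ : P *m Q = 0.

Let QP : Q *m P = 0.
Proof. by rewrite -trP -trQ -trmx_mul PQ trmx0. Qed.

Lemma block_square_zero S : P *m S *m Q = S -> S *m S = 0.
Proof. by move=> <-; rewrite !mulmxA -(mulmxA (P *m S)) QP mulmx0 !mul0mx. Qed.

(** The character at [y] is a product of matrices of inner size [k]; this factorization bounds every
    rank by [k]. *)
Lemma gl_support (v : 'rV_d) (T : 'M[F]_n) : v != 0 -> Q *m T *m P = T ->
    (forall (u : glmx F n) S, P *m S *m Q = S -> u = 1%:M + S :> 'M_n ->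
       v *m r1 u = chi0 (\tr (T *m S)) *: v) ->
  exists y : 'M[F]_(k, n), T = c *: (Q *m y^T *m (y *m P)).
Proof.
move=> nzv ET vE; have [ev [basis evU _]] := gl_model QQ trQ.
have [cv [Ev [y nzy]]] := basis_support basis nzv.
exists y; apply/eqP; rewrite -subr_eq0; apply/eqP; apply: mxtrace_nondegenerate => M.
have ES : P *m (P *m M *m Q) *m Q = P *m M *m Q.
  by rewrite !mulmxA PP -mulmxA QQ.
have EQP (B : 'M[F]_n) : \tr (Q *m B *m P *m M) = \tr (B *m (P *m M *m Q)).
  by rewrite !mulmxA [RHS]mxtrace_mulC !mulmxA.
have -> : c *: (Q *m y^T *m (y *m P)) = Q *m (c *: (y^T *m y)) *m P.
  by rewrite -scalemxAr -scalemxAl !mulmxA.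
rewrite -ET mulmxBl linearB /= !EQP; apply/eqP; rewrite subr_eq0 eq_sym; apply/eqP.
apply: (character_trace_inj chi0_nt (L := [pred S | P *m S *m Q == S])); last exact/eqP.
  by move=> z S /eqP LS; apply/eqP; rewrite -scalemxAr -scalemxAl LS.
move=> S /eqP LS; have SS := block_square_zero LS.
pose u := GLmx (square_zero_unit SS).
have := eigen_support (A := r1 u)
  (lam := fun y => chi0 (c * \tr (y^T *m y *m S))) basis _ _ nzy.
rewrite -scalemxAl linearZ /=; apply=> [z|]; last by rewrite -Ev (vE u S).
apply: evU => //; first by rewrite -{1}LS -mulmxA QQ LS.
by rewrite -LS !mulmxA QP !mul0mx.
Qed.

End Support.

Section Subrepresentation.
Variables (m : nat) (pi : mx_representation C [set: glmx F n] m) (f : 'M[C]_(m, d)).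
Hypothesis ff : row_free f.
Hypothesis hf : intertwines pi r1 f.

Lemma gl_occurs (a : {ffun 'I_n -> 'I_n.+1}) (j l : 'I_n) T : (j < l)%N ->
    block_supported a l j T ->
    character_occurs chi0 (block_supported a j l) (@unipotent F n) pi T ->
  exists2 x : 'rV_m, x != 0 & exists2 y : 'M[F]_(k, n),
    T = c *: (block_proj F a l *m y^T *m (y *m block_proj F a j)) &
    forall (u : glmx F n) S, block_proj F a j *m S *m block_proj F a l = S ->
      u = 1%:M + S :> 'M_n -> x *m pi u = chi0 (\tr (T *m S)) *: x.
Proof.
move=> lt_jl LT /character_occursP[x nzx xE].
have [PP trP] := (block_proj_idem F a j, block_proj_tr F a j).
have [QQ trQ] := (block_proj_idem F a l, block_proj_tr F a l).
have PQ := block_proj_disjoint F a lt_jl.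
have xE' (u : glmx F n) S : block_proj F a j *m S *m block_proj F a l = S ->
    u = 1%:M + S :> 'M_n -> x *m pi u = chi0 (\tr (T *m S)) *: x.
  move=> LS Eu; rewrite -xE; last by rewrite block_supportedE LS.
  congr (_ *m pi _); apply: val_inj; rewrite [LHS]Eu.
  by rewrite -[LHS]unipotentE // (block_square_zero trP trQ PQ LS).
exists x => //.
have [||u S LS Eu|y Ey] := @gl_support _ _ PP trP QQ trQ PQ (x *m f) T.
- by rewrite mulmx_free_eq0.
- by apply/eqP; rewrite -block_supportedE.
- by rewrite -mulmxA -hf ?inE // mulmxA (xE' u S) // scalemxAl.
by exists y.
Qed.

Lemma GL_urank_le : (GL_urank chi0 pi <= k)%N.
Proof.
apply/bigmax_leqP => a _; apply/bigmax_leqP => j _; apply/bigmax_leqP => l lt_jl.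
apply/bigmax_leqP => T /andP[LT /(gl_occurs lt_jl LT)[x _ [y -> _]]].
apply: leq_trans (mxrank_scale _ _) _.
exact: leq_trans (mxrankM_maxr _ _) (leq_trans (mxrankM_maxl _ _) (rank_leq_row _)).
Qed.

End Subrepresentation.
End GLPair.

(** * The upper right block of GL_{k+m} *)

Section SplitBlocks.
Variables (R : fieldType) (k m : nat).

Definition lower_proj : 'M[R]_(k + m) := block_mx 0 0 0 1%:M.

Lemma lower_proj_idem : lower_proj *m lower_proj = lower_proj.
Proof. by rewrite mulmx_block !(mul0mx, mulmx0, mulmx1, addr0, add0r). Qed.

Lemma lower_proj_tr : lower_proj^T = lower_proj.
Proof. by rewrite tr_block_mx !trmx0 trmx1. Qed.

Lemma upper_block_trace (y1 : 'M[R]_k) (y2 z : 'M[R]_(k, m)) :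
  \tr ((row_mx y1 y2)^T *m row_mx y1 y2 *m block_mx 0 z 0 0) = \tr (y2^T *m y1 *m z).
Proof.
rewrite tr_row_mx mul_col_row mulmx_block !(mul0mx, mulmx0, addr0, add0r).
by rewrite mxtrace_block mxtrace0 add0r.
Qed.

Lemma upper_blockE (z : 'M[R]_(k, m)) :
  block_mx 1%:M z 0 1%:M = 1%:M + block_mx 0 z 0 0 :> 'M_(k + m).
Proof. by rewrite (scalar_mx_block k m 1) add_block_mx !(addr0, add0r). Qed.

Lemma lower_proj_act (A A' : 'M[R]_k) (y1 p p' : 'M[R]_k)
    (y2 : 'M[R]_(k, m)) (q q' : 'M[R]_m) :
  A *m row_mx y1 y2 *m (1%:M - lower_proj) *m block_mx p 0 0 q
    + A' *m row_mx y1 y2 *m lower_proj *m block_mx p' 0 0 q'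
  = row_mx (A *m y1 *m p) (A' *m y2 *m q').
Proof.
rewrite /lower_proj (scalar_mx_block k m 1) opp_block_mx add_block_mx.
rewrite !(oppr0, addr0, subrr, subr0) !mul_mx_row !mul_row_block.
by rewrite !(mul0mx, mulmx0, mulmx1, addr0, add0r) add_row_mx addr0 add0r.
Qed.

Lemma invmx_diag_block (p : 'M[R]_k) (q : 'M[R]_m) : p \in unitmx -> q \in unitmx ->
  invmx (block_mx p 0 0 q) = block_mx (invmx p) 0 0 (invmx q).
Proof.
move=> up uq; apply: invmx_eq; rewrite mulmx_block !(mul0mx, mulmx0, addr0, add0r).
by rewrite !mulmxV // -scalar_mx_block.
Qed.

End SplitBlocks.

Section UpperBlocks.
Variables (F : finFieldType) (k m : nat).

Lemma upper_subproof (z : 'M[F]_(k, m)) : block_mx 1%:M z 0 1%:M \in unitmx.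
Proof. by rewrite unitmxE det_ublock !det1 mulr1 unitr1. Qed.
Definition upper (z : 'M[F]_(k, m)) : glmx F (k + m) := GLmx (upper_subproof z).

Lemma diag_subproof (p : glmx F k) (q : glmx F m) :
  block_mx (p : 'M_k) 0 0 (q : 'M_m) \in unitmx.
Proof. by rewrite unitmxE det_ublock unitrM -!unitmxE !glvalP. Qed.
Definition diag_gl (p : glmx F k) (q : glmx F m) : glmx F (k + m) :=
  GLmx (diag_subproof p q).

Lemma upperM z z' : (upper z * upper z')%g = upper (z + z').
Proof.
apply: val_inj; rewrite /= mulmx_block !(mul0mx, mulmx0, mul1mx, mulmx1, addr0, add0r).
by rewrite [z' + z]addrC.
Qed.

Lemma upper0 : upper 0 = 1%g.
Proof. by apply: val_inj; rewrite /= -scalar_mx_block. Qed.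

Lemma upper_group_set : group_set [set upper z | z in [set: 'M[F]_(k, m)]].
Proof.
apply/group_setP; split; first by rewrite -upper0 imset_f.
by move=> _ _ /imsetP[z _ ->] /imsetP[z' _ ->]; rewrite upperM imset_f.
Qed.
Canonical upper_group := Group upper_group_set.

Lemma upper_abelian : abelian upper_group.
Proof.
apply/centsP=> _ /imsetP[z _ ->] _ /imsetP[z' _ ->].
by rewrite /commute !upperM addrC.
Qed.

Lemma diag_upper (p : glmx F k) (q : glmx F m) z :
  (diag_gl p q * upper z)%g = (upper (p *m z *m invmx q) * diag_gl p q)%g.
Proof.
apply: val_inj; rewrite /= !mulmx_block.
by rewrite !(mul0mx, mulmx0, mul1mx, mulmx1, addr0, add0r) mulmxKV ?glvalP.
Qed.

End UpperBlocks.

(** A simple module of an abelian group over an algebraically closed field is a line. *)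
Lemma common_eigenvector (C : numClosedFieldType) (gT : finGroupType)
    (G A : {group gT}) m (pi : mx_representation C G m) (V : 'M_m) :
    abelian A -> A \subset G -> V != 0 ->
    {in A, forall a, (V *m pi a <= V)%MS} ->
  exists x : 'rV_m, exists lam : gT -> C,
    [/\ x != 0, (x <= V)%MS & {in A, forall a, x *m pi a = lam a *: x}].
Proof.
move=> abA sAG nzV stV; pose piA := subg_repr pi sAG.
have modV : mxmodule piA V by apply/mxmoduleP.
have [M simM sMV] := dec_mxsimple_exists modV nzV.
have rkM := mxsimple_abelian_linear (@group_closure_closed_field C gT A) abA simM.
have [modM nzM _] := simM.
have [x [lam defM xE]] := mxmodule_eigenvector modM rkM.
exists x, lam; split=> //; last by rewrite -defM.
by apply: contraNneq nzM => x0; rewrite -submx0 defM x0 sub0mx.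
Qed.

(** The block sizes are [k], [m] and then zeros; [0 < k <= m] guarantees that a second index
    exists. *)
Lemma two_block_composition (F : finFieldType) k m : (0 < k)%N -> (k <= m)%N ->
  exists (a : {ffun 'I_(k + m) -> 'I_(k + m).+1}) (j l : 'I_(k + m)),
  [/\ is_composition a, (j < l)%N,
      forall S : 'M[F]_(k + m), block_supported a j l S ->
        exists z : 'M[F]_(k, m), S = block_mx 0 z 0 0 &
      forall t : 'M[F]_(m, k), block_supported a l j (block_mx 0 0 t 0 : 'M_(k + m))].
Proof.
move=> k_gt0 le_km.
have lt0 : (0 < k + m)%N by rewrite addn_gt0 k_gt0.
have lt1 : (1 < k + m)%N by rewrite -[2%N]/(1 + 1)%N leq_add // (leq_trans k_gt0).
pose j0 := Ordinal lt0; pose l0 := Ordinal lt1.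
pose a : {ffun 'I_(k + m) -> 'I_(k + m).+1} :=
  [ffun i => if i == j0 then inord k else if i == l0 then inord m else ord0].
have aj : a j0 = k :> nat by rewrite ffunE eqxx inordK // ltnS leq_addr.
have al : a l0 = m :> nat by rewrite ffunE /= inordK // ltnS leq_addl.
have blockj i : in_block a j0 i = (i < k)%N.
  by rewrite /in_block big_pred0 ?aj // => j'; rewrite ltn0.
have blockl i : in_block a l0 i = (k <= i)%N.
  have Ek : (\sum_(j' < k + m | j' < l0) a j')%N = k.
    rewrite (big_pred1 j0) ?aj // => j' /=.
    by rewrite ltnS leqn0.
  by rewrite /in_block Ek al ltn_ord andbT.
exists a, j0, l0; split=> //.
- rewrite /is_composition (bigD1 j0) //= aj (bigD1 l0) //= al big1 ?addn0 // => i.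
  by rewrite ffunE => /andP[/negPf-> /negPf->].
- move=> S /forallP supp.
  have S0 (i1 i2 : 'I_(k + m)) : ~~ ((i1 < k) && (k <= i2))%N -> S i1 i2 = 0.
    move=> ni; apply/eqP; apply: contraNT ni => nz.
    by have := forallP (supp i1) i2; rewrite nz blockj blockl.
  exists (ursubmx S); rewrite -[LHS]submxK; congr block_mx.
  + by apply/matrixP=> i1 i2; rewrite !mxE S0 //= [(k <= _)%N]leqNgt !ltn_ord.
  + by apply/matrixP=> i1 i2; rewrite !mxE S0 //= ltnNge leq_addr.
  by apply/matrixP=> i1 i2; rewrite !mxE S0 //= ltnNge leq_addr.
move=> t; apply/forallP=> i1; apply/forallP=> i2; apply/implyP.
rewrite blockl blockj; case: (split_ordP i1) => i1' ->; case: (split_ordP i2) => i2' ->;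
  rewrite ?block_mxEul ?block_mxEur ?block_mxEdl ?block_mxEdr ?mxE ?eqxx //=.
by move=> _; rewrite leq_addr.
Qed.

(** * Rank and correspondence for the pair of GL_k and GL_{k+m} *)

Section GLSplitPair.
Variables (F : finFieldType) (C : numClosedFieldType) (chi chi0 : F -> C).
Hypothesis oddF : 2%N \notin [pchar F].
Hypothesis chi0_nt : nontrivial_character chi0.
Variable c : F.
Hypothesis nzc : c != 0.
Hypothesis chi_opp : forall x, chi (- x) = chi0 (c * x).
Variables (k m d : nat).
Hypothesis le_km : (k <= m)%N.
Local Notation n := (k + m)%N.
Variable omega : mx_representation C (form_isom (sympl_form F (k * n))) d.
Hypothesis osc : oscillator chi omega.

Local Notation r := (@gl_dual_pair F C n k d omega).
Local Notation r1 := (res_fst r).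
Local Notation r2 := (res_snd r).

Definition upper_char (y1 : 'M[F]_k) (y2 : 'M[F]_(k, m)) : 'M[F]_(m, k) :=
  c *: (y2^T *m y1).

Lemma gl_split_model :
  exists ev : 'M[F]_(k, n) -> 'rV[C]_d,
  [/\ basis_family ev,
      forall z y1 y2, ev (row_mx y1 y2) *m r1 (upper z)
        = chi0 (\tr (upper_char y1 y2 *m z)) *: ev (row_mx y1 y2),
      forall g : glmx F k, exists2 eps, eps != 0 & forall y1 y2,
        ev (row_mx y1 y2) *m r2 g = eps *: ev (row_mx (invmx g *m y1) (g^T *m y2)) &
      forall (p : glmx F k) (q : glmx F m), exists2 eps, eps != 0 & forall y1 y2,
        ev (row_mx y1 y2) *m r1 (diag_gl p q)
        = eps *: ev (row_mx (y1 *m p) (y2 *m (invmx q)^T))].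
Proof.
have [ev [basis evU evG]] := gl_model oddF chi_opp osc (lower_proj_idem F k m)
                               (lower_proj_tr F k m).
have evD (p : glmx F k) (q : glmx F m) g : exists2 eps, eps != 0 & forall y1 y2,
    ev (row_mx y1 y2) *m r (diag_gl p q, g)
    = eps *: ev (row_mx (invmx g *m y1 *m p) (g^T *m y2 *m (invmx q)^T)).
  have [|eps nz E] := evG (diag_gl p q) g.
    by rewrite /= !mulmx_block !(mul0mx, mulmx0, mulmx1, mul1mx, addr0, add0r).
  exists eps => // y1 y2; rewrite E /= invmx_diag_block ?glvalP // tr_block_mx !trmx0.
  by rewrite lower_proj_act.
exists ev; split=> // [z y1 y2 | g | p q].
- rewrite (evU _ (block_mx 0 z 0 0)) /=.
  + by rewrite upper_block_trace /upper_char -scalemxAl linearZ.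
  + exact: upper_blockE.
  + by rewrite mulmx_block !(mul0mx, mulmx0, mulmx1, addr0, add0r).
  by rewrite mulmx_block !(mul0mx, mulmx0, mulmx1, addr0, add0r) block_mx0.
- have [eps nz E] := evD 1%g 1%g g; exists eps => // y1 y2.
  have D1 : diag_gl 1%g 1%g = 1%g :> glmx F n.
    by apply: val_inj; rewrite /= -scalar_mx_block.
  have -> : r2 g = r (1%g, g) by [].
  by rewrite -D1 E /= invmx1 trmx1 !mulmx1.
have [eps nz E] := evD p q 1%g; exists eps => // y1 y2.
have -> : r1 (diag_gl p q) = r (diag_gl p q, 1%g) by [].
by rewrite E /= invmx1 trmx1 !mul1mx.
Qed.

Section WithBasis.
Variable ev : 'M[F]_(k, n) -> 'rV[C]_d.
Hypothesis basis : basis_family ev.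
Hypothesis evU : forall z y1 y2, ev (row_mx y1 y2) *m r1 (upper z)
  = chi0 (\tr (upper_char y1 y2 *m z)) *: ev (row_mx y1 y2).
Hypothesis evG : forall g : glmx F k, exists2 eps, eps != 0 & forall y1 y2,
  ev (row_mx y1 y2) *m r2 g = eps *: ev (row_mx (invmx g *m y1) (g^T *m y2)).
Hypothesis evL : forall (p : glmx F k) (q : glmx F m), exists2 eps, eps != 0 &
  forall y1 y2, ev (row_mx y1 y2) *m r1 (diag_gl p q)
    = eps *: ev (row_mx (y1 *m p) (y2 *m (invmx q)^T)).

Definition upper_psi (y : 'M[F]_(k, n)) (u : glmx F n) : C :=
  chi0 (\tr (upper_char (lsubmx y) (rsubmx y) *m ursubmx (u : 'M_n))).

Let Y0 : 'M[F]_(k, m) := pid_mx k.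
Let y0 : 'M[F]_(k, n) := row_mx 1%:M Y0.
Let rY0 : \rank Y0^T = k.
Proof. by rewrite mxrank_tr rank_pid_mx. Qed.

Lemma upper_weightP p (v : 'M_(p, d)) :
  weight_space r (upper_group F k m) (upper_psi y0) v <->
  forall z, v *m r1 (upper z) = chi0 (\tr (upper_char 1%:M Y0 *m z)) *: v.
Proof.
split=> [wv z | wv _ /imsetP[z _ ->]].
  have /wv -> : upper z \in upper_group F k m by apply: imset_f.
  by rewrite /upper_psi /= block_mxKur row_mxKl row_mxKr.
by rewrite wv // /upper_psi /= block_mxKur row_mxKl row_mxKr.
Qed.

Section Subrepresentation.
Variables (e : nat) (pi : mx_representation C [set: glmx F n] e) (f : 'M[C]_(e, d)).
Hypothesis ff : row_free f.
Hypothesis hf : intertwines pi r1 f.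

(* Some conjugate of a subgroup of the given matrix group on which the rank is *)
(* still k lies in the upper right block, whose characters extend the one of   *)
(* the subgroup, so that their rank is k as well.                              *)
Lemma upper_eigenvector : (0 < k)%N -> GL_urank chi0 pi = k ->
  exists2 x : 'rV_e, x != 0 & exists y1 y2, \rank (upper_char y1 y2) = k /\
    forall z, x *m pi (upper z) = chi0 (\tr (upper_char y1 y2 *m z)) *: x.
Proof.
move=> k_gt0 /bigmax_attained/(_ k_gt0)[a _ /bigmax_attained/(_ k_gt0)[j _]].
move=> /bigmax_attained/(_ k_gt0)[l lt_jl /bigmax_attained/(_ k_gt0)[T /andP[LT occ] rT]].
have [x nzx [y ET xE]] := gl_occurs oddF chi0_nt chi_opp osc ff hf lt_jl LT occ.
set P := block_proj F a j in ET xE; set Q := block_proj F a l in ET xE.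
have PP : P *m P = P := block_proj_idem F a j.
have QQ : Q *m Q = Q := block_proj_idem F a l.
have [trP trQ] : P^T = P /\ Q^T = Q by split; apply: block_proj_tr.
have PQ : P *m Q = 0 := block_proj_disjoint F a lt_jl.
have QP : Q *m P = 0 by rewrite -trP -trQ -trmx_mul PQ trmx0.
(* [T] factors through dimension [k]; having rank [k] itself, it forces both factors to have rank
   [k]. *)
pose v := y *m P; pose la := c *: (Q *m y^T).
have {}ET : T = la *m v by rewrite ET scalemxAl.
have rv : \rank v = k.
  by apply/eqP; rewrite eqn_leq rank_leq_row -[X in (X <= _)%N]rT ET mxrankM_maxr.
have rla : \rank la = k.
  by apply/eqP; rewrite eqn_leq rank_leq_col -[X in (X <= _)%N]rT ET mxrankM_maxl.
(* [w] is a right inverse of [v] fixed by [P]. The elements [1 + w *m Z] with [Z *m Q = Z] form the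
   subgroup to be conjugated, and [T] restricts on it to the trace of [la *m Z]. *)
pose w := P *m pinvmx v.
have vw : v *m w = 1%:M by rewrite /w mulmxA -(mulmxA y) PP mulmxVp // /row_free rv.
have rw : \rank w = k.
  apply/eqP; rewrite eqn_leq rank_leq_col -[X in (X <= _)%N](mxrank1 F k) -vw.
  exact: mxrankM_maxr.
pose e1 : 'M[F]_(n, k) := col_mx 1%:M 0.
have re1 : \rank e1 = k.
  apply/eqP; rewrite eqn_leq rank_leq_col -[X in (X <= _)%N](mxrank1 F k).
  have <- : row_mx 1%:M 0 *m e1 = 1%:M by rewrite mul_row_col mulmx1 mulmx0 addr0.
  exact: mxrankM_maxr.
(* Conjugation by [G] turns the columns of [w] into the first [k] unit vectors; since [Z *m w = 0],
   the conjugate of [1 + w *m Z] has only an upper right block. *)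
have [G uG EG] := complete_left rw re1.
pose g : glmx F n := GLmx uG.
pose uZ (Z : 'M[F]_(k, n)) := upper (rsubmx (Z *m invmx G)).
have wZ (Z : 'M[F]_(k, n)) : Z *m Q = Z ->
    x *m pi g^-1%g *m pi (uZ Z) = chi0 (\tr (la *m Z)) *: (x *m pi g^-1%g).
  move=> ZQ; pose S := w *m Z.
  have Zw : Z *m w = 0 by rewrite -ZQ /w mulmxA -(mulmxA Z) QP mulmx0 mul0mx.
  have SS : S *m S = 0 by rewrite /S mulmxA -(mulmxA w) Zw mulmx0 mul0mx.
  pose u : glmx F n := GLmx (square_zero_unit SS).
  have Eu : (u * g^-1 = g^-1 * uZ Z)%g.
    apply: (mulgI g); rewrite mulKVg mulgA; apply: (mulIg g); rewrite mulgKV.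
    apply: val_inj; rewrite /= upper_blockE mulmxDr mulmxDl mulmx1 mul1mx; congr (_ + _).
    have -> : block_mx 0 (rsubmx (Z *m invmx G)) 0 0 = e1 *m (Z *m invmx G).
      rewrite -[in RHS](hsubmxK (Z *m invmx G)) mul_col_row !mul1mx !mul0mx.
      suff -> : lsubmx (Z *m invmx G) = 0 by [].
      have <- : Z *m invmx G *m e1 = lsubmx (Z *m invmx G).
        by rewrite -{1}[Z *m invmx G]hsubmxK mul_row_col mulmx1 mulmx0 addr0.
      by rewrite -EG mulmxA mulmxKV.
    by rewrite /S mulmxA EG -!mulmxA mulVmx // mulmx1.
  have PSQ : P *m S *m Q = S by rewrite /S /w !mulmxA PP -!mulmxA ZQ.
  rewrite -mulmxA -repr_mxM ?inE // -Eu repr_mxM ?inE // mulmxA (xE u S) //.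
  rewrite -scalemxAl; congr (chi0 (\tr _) *: _).
  by rewrite ET /S mulmxA -(mulmxA la) vw mulmx1.
pose V : 'M[C]_e := (\bigcap_(Z : 'M[F]_(k, n) | Z *m Q == Z)
                      eigenspace (pi (uZ Z)) (chi0 (\tr (la *m Z))))%MS.
have VP p (W : 'M_(p, e)) : reflect
    (forall Z, Z *m Q = Z -> W *m pi (uZ Z) = chi0 (\tr (la *m Z)) *: W) (W <= V)%MS.
  apply: (iffP sub_bigcapmxP) => WE Z /eqP ZQ; first exact/eigenspaceP/WE.
  by apply/eigenspaceP; apply: WE.
have nzV : V != 0.
  apply: contraNneq nzx => V0; have /VP : forall Z, Z *m Q = Z ->
      x *m pi g^-1%g *m pi (uZ Z) = chi0 (\tr (la *m Z)) *: (x *m pi g^-1%g) by [].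
  rewrite V0 submx0 mulmx_free_eq0 // row_free_unit.
  by apply: repr_mx_unit; rewrite inE.
(* The subgroup lies in the abelian group of upper right blocks, which therefore preserves its
   eigenspace [V] and has an eigenvector there. *)
have stV : {in upper_group F k m, forall b, (V *m pi b <= V)%MS}.
  move=> _ /imsetP[z _ ->]; apply/VP => Z ZQ.
  have VE : V *m pi (uZ Z) = chi0 (\tr (la *m Z)) *: V by apply: (VP _ _ (submx_refl _)).
  rewrite -mulmxA -repr_mxM ?inE // /uZ upperM addrC -upperM repr_mxM ?inE //.
  by rewrite mulmxA VE -scalemxAl.
have [x2 [lam [nzx2 /VP x2V x2E]]] :=
  common_eigenvector (upper_abelian F k m) (subsetT _) nzV stV.
have upE z : upper z \in upper_group F k m by apply: imset_f.
have nzx2f : x2 *m f != 0 by rewrite mulmx_free_eq0.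
have [cv [Ev [y' nzy']]] := basis_support basis nzx2f.
have lamE z : lam (upper z) = chi0 (\tr (upper_char (lsubmx y') (rsubmx y') *m z)).
  symmetry; apply: (eigen_support (A := r1 (upper z))
    (lam := fun y => chi0 (\tr (upper_char (lsubmx y) (rsubmx y) *m z))) basis _ _ nzy').
    by move=> y2; rewrite -{1 4}[y2]hsubmxK evU.
  by rewrite -Ev -mulmxA -hf ?inE // mulmxA x2E ?upE // scalemxAl.
exists x2 => //; exists (lsubmx y'), (rsubmx y'); split; last first.
  by move=> z; rewrite x2E ?upE // lamE.
set t := upper_char _ _ in lamE *.
pose Gr := rsubmx (invmx G).
have trE Z : Z *m Q = Z -> \tr (la *m Z) = \tr (Gr *m t *m Z).
  move/eqP; move: Z; apply: (character_trace_inj chi0_nt (L := [pred Z | Z *m Q == Z])).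
    by move=> z Z /eqP ZQ; apply/eqP; rewrite -scalemxAl ZQ.
  move=> Z /eqP ZQ; have := x2V Z ZQ.
  rewrite (x2E _ (upE _)) => /eqP; rewrite -subr_eq0 -scalerBl scaler_eq0 (negPf nzx2) orbF.
  rewrite subr_eq0 lamE => /eqP <-; congr (chi0 _).
  by rewrite -mulmx_rsub -[in RHS]mulmxA [RHS]mxtrace_mulC -[in RHS]mulmxA.
(* The new character [t] extends the one on the subgroup, so [la] is a multiple of [t]; thus [t] has
   rank at least [k]. *)
have Ela : la = Q *m (Gr *m t).
  apply/eqP; rewrite -subr_eq0; apply/eqP; apply: mxtrace_nondegenerate => M.
  rewrite mulmxBl linearB /=; apply/eqP; rewrite subr_eq0; apply/eqP.
  have <- : Q *m la = la by rewrite /la -scalemxAr mulmxA QQ.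
  rewrite -!(mulmxA Q) [LHS]mxtrace_mulC [RHS]mxtrace_mulC -!(mulmxA _ M).
  by apply: trE; rewrite -mulmxA QQ.
apply/eqP; rewrite eqn_leq rank_leq_col -[X in (X <= _)%N]rla Ela mulmxA.
exact: mxrankM_maxr.
Qed.

Lemma gl_rank_weight : (0 < e)%N ->
  GL_urank chi0 pi = k <->
  exists2 x : 'rV_e, x != 0 & weight_space r (upper_group F k m) (upper_psi y0) (x *m f).
Proof.
(* For [k = 0] the upper right block is empty and both sides hold. *)
move=> e_gt0; have [k0 | k_gt0] := posnP k.
  split=> _.
    exists (delta_mx 0 (Ordinal e_gt0)).
      apply/rV0Pn; exists (Ordinal e_gt0); rewrite mxE !eqxx; exact: oner_neq0.
    apply/upper_weightP => z; have -> : z = 0.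
      by apply/matrixP=> i; have := ltn_ord i; rewrite {2}k0.
    have [chi00 _ _] := chi0_nt.
    by rewrite upper0 repr_mx1 mulmx1 mulmx0 mxtrace0 chi00 scale1r.
  by apply/eqP; rewrite eqn_leq (GL_urank_le oddF chi0_nt chi_opp osc ff hf) {1}k0.
split=> [rk | [x nzx /upper_weightP wx]]; last first.
  apply/eqP; rewrite eqn_leq (GL_urank_le oddF chi0_nt chi_opp osc ff hf) /=.
  have [a [j [l [comp lt_jl supp suppT]]]] := two_block_composition F k_gt0 le_km.
  pose t := upper_char 1%:M Y0.
  pose T : 'M[F]_n := block_mx 0 0 t 0.
  have rT : \rank T = k.
    rewrite /T /block_mx row_mx0 rank_col_0mx rank_row_mx0.
    by rewrite /t /upper_char mxrank_scale_nz // mulmx1 rY0.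
  apply: (bigop.bigmax_sup a) => //; apply: (bigop.bigmax_sup j) => //.
  apply: (bigop.bigmax_sup l) => //; rewrite -[X in (X <= _)%N]rT.
  apply: leq_bigmax_cond; rewrite suppT; apply/character_occursP.
  exists x => // S /supp[z ->].
  have -> : unipotent (block_mx 0 z 0 0 : 'M_n) = upper z.
    apply: val_inj; rewrite [LHS]unipotentE /= ?upper_blockE //.
    by rewrite mulmx_block !(mul0mx, mulmx0, addr0) block_mx0.
  have -> : \tr (T *m block_mx 0 z 0 0) = \tr (t *m z).
    rewrite mulmx_block !(mul0mx, mulmx0, addr0, add0r).
    by rewrite mxtrace_block mxtrace0 add0r.
  by apply: (row_free_inj ff); rewrite -mulmxA hf ?inE // mulmxA wx scalemxAl.
have [x nzx [y1 [y2 [rt xE]]]] := upper_eigenvector k_gt0 rk.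
move: rt; rewrite /upper_char mxrank_scale_nz // => rt.
have ry2 : \rank y2^T = k.
  apply/eqP; rewrite eqn_leq rank_leq_col -[X in (X <= _)%N]rt; exact: mxrankM_maxl.
have uy1 : y1 \in unitmx.
  rewrite -row_full_unit /row_full eqn_leq rank_leq_col -[X in (X <= _)%N]rt.
  exact: mxrankM_maxr.
have [b ub Eb] := complete_left ry2 rY0.
have uy1V : invmx y1 \in unitmx by rewrite unitmx_inv.
have ubV : invmx b \in unitmx by rewrite unitmx_inv.
(* With [b *m y2^T = Y0^T], these two blocks carry the character of [(y1, y2)] to that of the base
   point. *)
pose h := diag_gl (GLmx uy1V) (GLmx ubV).
exists (x *m pi h).
  by rewrite mulmx_free_eq0 // row_free_unit repr_mx_unit ?inE.
apply/upper_weightP => z.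
have xfE z' : x *m f *m r1 (upper z') = chi0 (\tr (upper_char y1 y2 *m z')) *: (x *m f).
  by rewrite -mulmxA -hf ?inE // mulmxA xE scalemxAl.
rewrite -(mulmxA x) hf ?inE // mulmxA -(mulmxA (x *m f)) -repr_mxM ?inE //.
rewrite diag_upper repr_mxM ?inE // mulmxA xfE -scalemxAl; congr (chi0 _ *: _).
rewrite /= invmxK /upper_char -!scalemxAl !linearZ /=; congr (_ * _).
by rewrite !mulmxA mulmxK // mxtrace_mulC !mulmxA Eb mulmx1.
Qed.

End Subrepresentation.

(** The equation [y2^T *m y1 = Y0^T] forces [y1] to be invertible and then determines [y2], so the
    fibre is a free orbit of GL_k. *)
Lemma gl_correspondence :
  exists2 eta, eta_correspondence r (fun _ pi => GL_urank chi0 pi = k) eta &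
    forall j, exists f, row_free f /\ intertwines (irr_repr (eta j)) r1 f.
Proof.
have [eps epsE] : exists eps : glmx F k -> C, forall g,
    eps g != 0 /\ forall y1 y2, ev (row_mx y1 y2) *m r2 g
      = eps g *: ev (row_mx (invmx g *m y1) (g^T *m y2)).
  apply: (@fin_all_exists _ (fun=> C) (fun g e1 => e1 != 0 /\ forall y1 y2,
    ev (row_mx y1 y2) *m r2 g = e1 *: ev (row_mx (invmx g *m y1) (g^T *m y2)))) => g.
  by have [e1 nz E] := evG g; exists e1.
apply: (@monomial_correspondence _ _ _ _ _ _ r _ ev (upper_group F k m) upper_psi y0
          (fun g => row_mx (invmx g) (g^T *m Y0)) eps) => //.
- exact: subsetT.
- move=> y _ /imsetP[z _ ->]; rewrite -{1 3}[y]hsubmxK evU.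
  by rewrite /upper_psi /= block_mxKur.
- by move=> g _; case: (epsE g).
- by move=> g _; have [_ ->] := epsE g; rewrite mulmx1.
- move=> g g' _ _ /eq_row_mx[Eg _].
  by apply: val_inj; rewrite /= -[val g]invmxK [invmx (val g)]Eg invmxK.
- move=> y Ey; set y1 := lsubmx y; set y2 := rsubmx y.
  have Et : upper_char y1 y2 = upper_char 1%:M Y0.
    apply/eqP; rewrite -subr_eq0; apply/eqP; apply: mxtrace_nondegenerate => z.
    rewrite mulmxBl linearB /=; apply/eqP; rewrite subr_eq0; apply/eqP.
    apply: (character_trace_inj chi0_nt (L := predT)) => // {}z _.
    have := Ey _ (imset_f (@upper F k m) (in_setT z)).
    by rewrite /upper_psi /= block_mxKur row_mxKl row_mxKr.
  have {}Et : y2^T *m y1 = Y0^T.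
    have := congr1 (fun M => c^-1 *: M) Et.
    by rewrite /upper_char !scalerA mulVf // !scale1r mulmx1.
  have uy1 : y1 \in unitmx.
    rewrite -row_full_unit /row_full eqn_leq rank_leq_col -[X in (X <= _)%N]rY0 -Et.
    exact: mxrankM_maxr.
  have uV : invmx y1 \in unitmx by rewrite unitmx_inv.
  exists (GLmx uV); rewrite ?inE //= invmxK -[LHS]hsubmxK; congr row_mx.
  by apply: trmx_inj; rewrite trmx_mul trmxK -Et mulmxK.
- move=> g _.
  have rg : \rank (Y0^T *m (g : 'M_k)) = k.
    by rewrite mxrankMfree // row_free_unit glvalP.
  have [b ub Eb] := complete_left rY0 rg.
  have ubV : invmx b \in unitmx by rewrite unitmx_inv.
  (* The first block is dictated by [y1 = invmx g]; the second comes from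
     [b *m Y0^T = Y0^T *m g]. *)
  have [e1 nz E] := evL (g^-1)%g (GLmx ubV).
  exists (diag_gl (g^-1)%g (GLmx ubV)), e1; rewrite inE E /= invmxK mul1mx; split=> //.
  congr (_ *: ev (row_mx _ _)); apply: trmx_inj.
  by rewrite !trmx_mul !trmxK Eb.
move=> e pi f irr ff hf; apply: gl_rank_weight => //.
by case/mx_irrP: irr.
Qed.

End WithBasis.

Lemma gl_pair_main :
  GL_urank chi0 r1 = k /\
  exists eta, eta_correspondence r (fun _ pi => GL_urank chi0 pi = k) eta.
Proof.
have [ev [basis evU evG evL]] := gl_split_model.
have [eta eta_corr _] := gl_correspondence basis evU evG evL.
split; last by exists eta.
have free1 : row_free (1%:M : 'M[C]_d) by rewrite row_free_unit unitmx1.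
have hom1 : intertwines r1 r1 1%:M by move=> g _; rewrite mulmx1 mul1mx.
pose y0 : 'M[F]_(k, n) := row_mx 1%:M (pid_mx k).
have nz0 : ev y0 != 0.
  exact: basis_neq0.
apply/(gl_rank_weight basis evU free1 hom1).
  by rewrite lt0n; apply: contraNneq nz0 => d0; apply/eqP/rowP=> i;
       have := ltn_ord i; rewrite {2}d0.
by exists (ev y0) => //; apply/upper_weightP => z; rewrite mulmx1 evU.
Qed.

End GLSplitPair.

(** * Specialization to the three dual pairs *)

Lemma sympl_form_tr (F : finFieldType) n : (sympl_form F n)^T = - sympl_form F n.
Proof.
by rewrite tr_block_mx opp_block_mx !linearN /= !trmx0 trmx1 oppr0 opprK.
Qed.

Lemma sympl_form_unit (F : finFieldType) n : sympl_form F n \in unitmx.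
Proof.
suff /mulmx1_unit[] : sympl_form F n *m - sympl_form F n = 1%:M by [].
rewrite /sympl_form opp_block_mx mulmx_block !(mul0mx, mulmx0, mul1mx, addr0, add0r, oppr0).
by rewrite mulNmx mul1mx opprK -scalar_mx_block.
Qed.

Theorem theorem5p3p1 (F : finFieldType) (C : numClosedFieldType)
    (oddF : 2%N \notin [pchar F]) (chi chi0 : F -> C)
    (chi_nt : nontrivial_character chi) (chi0_nt : nontrivial_character chi0) :
  [/\ (* the pair (Sp_2n, O_k) *)
      exists2 c : F, c != 0 &
        forall (k n : nat) (B : 'M[F]_k), (k <= n)%N ->
        B^T = B -> B \in unitmx ->
        forall d (omega : mx_representation C
                   (form_isom (tprod (sympl_form F n) B)) d),
        oscillator chi omega ->
        let r := tensor_pair omega in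
        [/\ Sp_urank chi0 (res_fst r) = k,
            has_type chi0 (res_fst r) (c *: B) &
            exists eta,
              eta_correspondence r (fun _ pi => Sp_urank chi0 pi = k) eta /\
              forall i, has_type chi0 (irr_repr (eta i)) (c *: B)],
      (* the pair (O_{k,k}, Sp_2n) *)
      forall k n : nat, (2 * n <= k)%N ->
        forall d (omega : mx_representation C
                   (form_isom (tprod (split_form F k) (sympl_form F n))) d),
        oscillator chi omega ->
        let r := tensor_pair omega in
        O_urank chi0 (res_fst r) = (2 * n)%N /\
        exists eta,
          eta_correspondence r (fun _ pi => O_urank chi0 pi = (2 * n)%N) eta &
      (* the pair (GL_k, GL_n) *)
      forall k n : nat, (2 * k <= n)%N ->
        forall d (omega : mx_representation C
                   (form_isom (sympl_form F (k * n))) d),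
        oscillator chi omega ->
        let r := @gl_dual_pair F C n k d omega in
        GL_urank chi0 (res_fst r) = k /\
        exists eta,
          eta_correspondence r (fun _ pi => GL_urank chi0 pi = k) eta].
Proof.
have two : (2%:R : F) != 0 by move: oddF; rewrite inE.
have [c1 nzc1 Ec1] := character_scale chi_nt chi0_nt.
(* The Siegel shears carry the factor one half of the function model, while for GL only the sign of
   [mixed_bform] remains, hence [- c1]. *)
pose c := c1 * 2%:R^-1.
have nzc : c != 0 by rewrite mulf_neq0 ?invr_eq0.
have half x : chi (2%:R^-1 * x) = chi0 (c * x) by rewrite Ec1 mulrA.
have chi_opp x : chi (- x) = chi0 (- c1 * x) by rewrite Ec1 mulrN mulNr.
have nzNc1 : - c1 != 0 by rewrite oppr_eq0.
split.
- exists c => // k n B le_kn trB uB d omega osc r.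
  have defA : sympl_form F n = block_mx 0 1%:M (-1)%:M 0 by rewrite raddfN.
  have e2 : (-1) * (-1) = 1 :> F by rewrite mulrNN mulr1.
  have defL (S : 'M[F]_n) : symmetric_mx S = (S^T == - -1 *: S).
    by rewrite opprK scale1r.
  have trB' : B^T = - -1 *: B by rewrite opprK scale1r.
  have [rk typ [eta corr typ_eta]] :=
    siegel_pair oddF chi0_nt nzc half le_kn defA e2 defL trB' uB osc.
  split=> //; first by move=> T /eqP; apply: typ.
  by exists eta; split=> // i T /eqP; apply: typ_eta.
- move=> k n; have -> : (2 * n = n + n)%N by rewrite mul2n addnn.
  move=> le_nk d omega osc r.
  have defA : split_form F k = block_mx 0 1%:M 1%:M 0 by [].
  have e2 : 1 * 1 = 1 :> F by rewrite mulr1.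
  have defL (S : 'M[F]_k) : skew_mx S = (S^T == - 1 *: S) by rewrite scaleN1r.
  have trB : (sympl_form F n)^T = - 1 *: sympl_form F n.
    by rewrite scaleN1r sympl_form_tr.
  have [rk _ [eta corr _]] := siegel_pair oddF chi0_nt nzc half le_nk defA e2 defL trB
    (sympl_form_unit F n) osc.
  by split=> //; exists eta.
move=> k n le_kn.
(* The bound on [k] is exactly what makes the complementary block of size [n - k] at least as large
   as [k]. *)
have [m -> le_km] : exists2 m, n = (k + m)%N & (k <= m)%N.
  have le_kkn : (k + k <= n)%N by rewrite addnn -mul2n.
  have le_k : (k <= n)%N := leq_trans (leq_addr k k) le_kkn.
  by exists (n - k)%N; rewrite ?subnKC // leq_subRL.
by move=> d omega osc; apply: (gl_pair_main oddF chi0_nt nzNc1 chi_opp).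
Qed.
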